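(* Let $p\geq 3$ be a prime, let $n\ge 0$ and let $\tau=[a,b]$ be a two-row Young diagram with $n=a+b$ boxes and row lengths $a\ge b\ge 0$ satisfying $0\leq a-b\leq p-2$. Consider the sequence of Young diagrams $\tau_j$, $j\ge 0$, given by $\tau_{2i}=[a+ip,\,b-ip]$ and $\tau_{2i-1}=[b+ip-1,\,a-ip+1]$, whenever defined (so $\tau_0=\tau$, $\tau_1=[b+p-1,a-p+1]$, $\tau_2=[a+p,b-p]$, $\tau_3=[b+2p-1,a-2p+1]$, etc.). Then: 1. There is a resolution of the $p$-modular simple representation $\mathcal D^{\tau}_p$ of $S_n$ in terms of ordinary representations, given by an exact sequence of $S_n$-equivariant maps $$\cdots\longrightarrow \mathcal S^{\tau_2}_p\longrightarrow \mathcal S^{\tau_1}_p\longrightarrow \mathcal S^{\tau_0}_p\longrightarrow \mathcal D^{\tau}_p\to 0 .$$ 2. The $p$-modular character expands in ordinary characters as $$\varphi^{\tau}_p=\sum_{i\ge 0}(-1)^i\chi^{\tau_i}_p .$$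
   Context: $[a,b]$ denotes the two-row Young diagram with first row of length $a$ and second row of length $b$. A diagram $\tau_j$ is ''defined'' if its row lengths are nonnegative; when $\tau_j$ is not defined, the corresponding module and character are taken to be $0$. For a diagram $\tau$ with $n$ boxes, $\mathcal S^{\tau}_{\mathbb Z}$ is the integral Specht module: the sublattice of the permutation module $M^\tau_{\mathbb Z}$ (free on tabloids of shape $\tau$) generated by the polytabloids. $\mathcal S^{\tau}_p=\mathcal S^{\tau}_{\mathbb Z}/p\,\mathcal S^{\tau}_{\mathbb Z}$ is its reduction over $\mathbb F_p=\mathbb Z/p\mathbb Z$. It carries the symmetric $S_n$-invariant bilinear form induced from the one on $M^\tau_{\mathbb Z}$ for which tabloids are orthonormal, and $\mathcal D^{\tau}_p$ is the quotient of $\mathcal S^\tau_p$ by the null space (radical) of this form; for two-row $\tau$ and $p\ge3$ it is a (nonzero) simple $S_n$-module. $\chi^\tau_p$ is the character of $\mathcal S^\tau_p$ (the reduction mod $p$ of the $\mathbb Z$-valued character $\chi^\tau$ of $\mathcal S^\tau_{\mathbb Z}$), and $\varphi^\tau_p$ is the $\mathbb F_p$-valued character (trace) of $\mathcal D^\tau_p$. *)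

(* Defs.v *)
From HB Require Import structures.
From mathcomp Require Import all_boot all_order all_fingroup all_algebra.
From mathcomp Require Import generic_quotient boolp zify.

Set Implicit Arguments.
Unset Strict Implicit.
Unset Printing Implicit Defensive.

Import Order.TTheory GRing.Theory Num.Theory.

Local Open Scope ring_scope.
Local Open Scope quotient_scope.

Section FiniteDimension.

Variables (F : fieldType) (W : lmodType F).

Definition lcomb N (g : 'I_N -> W) (c : 'rV[F]_N) : W := \sum_i c 0 i *: g i.

Definition spanning N (g : 'I_N -> W) := forall x, exists c, x = lcomb g c.

Lemma lcomb_linear N (g : 'I_N -> W) : linear (lcomb g).
Proof.
move=> k c c'; rewrite /lcomb scaler_sumr -big_split /=.
by apply: eq_bigr => i _; rewrite !mxE scalerDl scalerA.
Qed.

Lemma lcomb_drop N (g : 'I_N -> W) (c : 'rV[F]_N) i :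
  spanning g -> c 0 i != 0 -> lcomb g c = 0 ->
  exists g' : 'I_N.-1 -> W, spanning g'.
Proof.
case: N g c i => [|N] g c i; first by case: i.
move=> gW ci0 gc0; exists (g \o lift i) => x.
have gi : g i = \sum_(j < N) (- (c 0 i)^-1 * c 0 (lift i j)) *: g (lift i j).
  move: gc0; rewrite /lcomb (bigD1_ord i) //= => /eqP.
  rewrite addr_eq0 => /eqP /(congr1 ( *:%R (c 0 i)^-1)).
  rewrite scalerA mulVf // scale1r => ->.
  rewrite scalerN -scaleNr scaler_sumr.
  by apply: eq_bigr => j _; rewrite scalerA.
have [e ->] := gW x.
exists (\row_j (e 0 (lift i j) - e 0 i * (c 0 i)^-1 * c 0 (lift i j))).
rewrite /lcomb (bigD1_ord i) //= gi scaler_sumr -big_split /=.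
apply: eq_bigr => j _; rewrite mxE scalerA -scalerDl; congr (_ *: _).
by rewrite addrC mulrA mulrN mulNr.
Qed.

Lemma spanning_vect_iso :
  (exists N (g : 'I_N -> W), spanning g) -> {N & Vector.axiom N W}.
Proof.
move=> exg.
pose P N := `[< exists g : 'I_N -> W, spanning g >].
have exP : exists N, P N by have [N [g gW]] := exg; exists N; apply/asboolP; exists g.
have [N /asboolP exgN Nmin] := ex_minnP exP.
have [g gW] := cid exgN; exists N.
have lcomb0 c : lcomb g c = 0 -> c = 0.
  move=> gc0; apply/rowP=> i; rewrite mxE; apply/eqP/negPn/negP=> ci0.
  have /asboolP/Nmin := lcomb_drop gW ci0 gc0.
  by case: N {g c exgN Nmin gW gc0 ci0} i => [[]//|N] _; rewrite ltnn.
have [h hK] := choice gW.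
have lcombK : cancel (lcomb g) h.
  move=> c; apply/eqP; rewrite -subr_eq0; apply/eqP/lcomb0.
  by rewrite -scaleN1r addrC lcomb_linear scaleN1r -hK addNr.
exists h; last by exists (lcomb g).
move=> k x y; apply: (can_inj lcombK).
by rewrite lcomb_linear -!hK.
Qed.

End FiniteDimension.

Section ElementaryQuotient.

Variables (p : nat) (V : zmodType) (I : zmodClosed V).

Definition finitely_generated :=
  exists (N : nat) (g : 'I_N -> V),
    forall x, exists c : 'I_N -> int, x = \sum_i g i *~ c i.

(* The proof arguments only serve to equip the quotient group V / I with its
   structure of finite-dimensional vector space over 'F_p. *)
Definition pquot (_ : prime p) (_ : forall x, x *+ p \in I)
    (_ : finitely_generated) : Type := Quotient.quot I.

Variables (p_pr : prime p) (pVI : forall x, x *+ p \in I).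
Variable fgV : finitely_generated.

Local Notation Q := (pquot p_pr pVI fgV).

HB.instance Definition _ := GRing.Zmodule.copy Q (Quotient.quot I).
HB.instance Definition _ := EqQuotient.copy Q (Quotient.quot I).
HB.instance Definition _ := ZmodQuotient.copy Q (Quotient.quot I).

Definition pquot_scale (k : 'F_p) (x : Q) : Q := x *+ k.

Lemma pquot_pi_eq0 v : (\pi_Q v == 0) = (v \in I).
Proof. by rewrite -(raddf0 (\pi_Q : V -> Q)) eqmodE /= /Quotient.equiv subr0. Qed.

Lemma pquot_mulrp (x : Q) : x *+ p = 0.
Proof. by elim/quotW: x => v; rewrite -raddfMn; apply/eqP; rewrite pquot_pi_eq0. Qed.

Lemma pquot_mulr_mod (x : Q) m : x *+ (m %% p) = x *+ m.
Proof.
by rewrite [in RHS](divn_eq m p) mulrnDr mulnC mulrnA pquot_mulrp mul0rn add0r.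
Qed.

Lemma val_FpM (k l : 'F_p) : (k * l)%R = (k * l %% p)%N :> nat.
Proof. by congr (_ %% _)%N; apply: Fp_cast. Qed.

Lemma val_FpD (k l : 'F_p) : (k + l)%R = ((k + l) %% p)%N :> nat.
Proof. by congr (_ %% _)%N; apply: Fp_cast. Qed.

Lemma pquot_scaleA k l x : pquot_scale k (pquot_scale l x) = pquot_scale (k * l) x.
Proof. by rewrite /pquot_scale val_FpM pquot_mulr_mod -mulrnA mulnC. Qed.

Lemma pquot_scale1 : left_id 1 pquot_scale.
Proof. by move=> x; rewrite /pquot_scale /= modn_small. Qed.

Lemma pquot_scaleDr : right_distributive pquot_scale +%R.
Proof. by move=> k x y; rewrite /pquot_scale mulrnDl. Qed.

Lemma pquot_scaleDl x : {morph pquot_scale^~ x : k l / k + l}.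
Proof. by move=> k l; rewrite /pquot_scale val_FpD pquot_mulr_mod mulrnDr. Qed.

HB.instance Definition _ := GRing.Zmodule_isLmodule.Build 'F_p Q
  pquot_scaleA pquot_scale1 pquot_scaleDr pquot_scaleDl.

Lemma pquot_fg : exists N (g : 'I_N -> Q),
  forall x, exists c : 'I_N -> int, x = \sum_i g i *~ c i.
Proof.
have [N [g gV]] := fgV; exists N, (\pi_Q \o g) => x.
elim/quotW: x => v; have [c ->] := gV v; exists c.
by rewrite raddf_sum; apply: eq_bigr => i _; rewrite raddfMz.
Qed.

Lemma pquot_spanning : exists N (g : 'I_N -> Q), spanning g.
Proof.
have [N [g gQ]] := pquot_fg; exists N, g => x; have [c ->] := gQ x.
exists (\row_i (c i)%:~R); apply: eq_bigr => i _.
by rewrite mxE scaler_int.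
Qed.

HB.instance Definition _ :=
  Lmodule_hasFinDim.Build 'F_p Q (projT2 (spanning_vect_iso pquot_spanning)).

End ElementaryQuotient.

(* A two-row diagram [a, b] is the pair (a, b); None stands for a diagram that
   is not defined. *)
Definition diagram := option (nat * nat).

Definition row_length (ab : nat * nat) (r : 'I_2) : nat :=
  if r == ord0 then ab.1 else ab.2.

Section Specht.

Variable n : nat.

(* The left action of 'S_n by replacing each entry i with s i. *)
Definition relabel (T : finType) (s : 'S_n) (t : {ffun 'I_n -> T}) :
    {ffun 'I_n -> T} := [ffun i => t (s^-1%g i)].

(* Columns can be indexed by 'I_n because a row has at most n boxes. *)
Definition box : finType := ('I_2 * 'I_n)%type.

Variable d : diagram.

(* t i is the box (row, column) containing the entry i. *)
Definition is_tableau (t : {ffun 'I_n -> box}) : bool :=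
  if d is Some ab then
    injectiveb t && [forall x : box, (x \in codom t) == (x.2 < row_length ab x.1)%N]
  else false.

(* f i is the row containing the entry i. An undefined diagram has no tabloids,
   so all the modules attached to it below are zero. *)
Definition is_tabloid (f : {ffun 'I_n -> 'I_2}) : bool :=
  if d is Some ab then [forall r, #|[set i | f i == r]| == row_length ab r]
  else false.

Definition tabloid : Type := {f : {ffun 'I_n -> 'I_2} | is_tabloid f}.

HB.instance Definition _ := SubFinite.on tabloid.

Lemma is_tabloid_relabel s f : is_tabloid f -> is_tabloid (relabel s f).
Proof.
rewrite /is_tabloid; case: d => // ab /forallP fP; apply/forallP=> r.
rewrite -(eqP (fP r)) -(card_preimset [set i | f i == r] (@perm_inj _ s^-1%g)).
by apply/eqP; apply: eq_card => i; rewrite !inE ffunE.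
Qed.

Definition tabloid_act (s : 'S_n) (T : tabloid) : tabloid :=
  exist _ (relabel s (val T)) (is_tabloid_relabel s (valP T)).

(* The permutation module over int: x T is the coefficient of T in x. *)
Definition permZ := {ffun tabloid -> int}.

Definition permZ_act (s : 'S_n) (x : permZ) : permZ :=
  [ffun T => x (tabloid_act s^-1 T)].

Definition tableau_rows (t : {ffun 'I_n -> box}) : {ffun 'I_n -> 'I_2} :=
  [ffun i => (t i).1].

Definition column_stabilizer (t : {ffun 'I_n -> box}) : {set 'S_n} :=
  [set s : 'S_n | [forall i, (t (s i)).2 == (t i).2]].

Definition polytabloid (t : {ffun 'I_n -> box}) : permZ :=
  [ffun T => \sum_(s in column_stabilizer t)
     (-1) ^+ s *+ (val T == tableau_rows (relabel s t))].

Definition spechtZ_pred : {pred permZ} := fun x =>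
  `[< exists c : {ffun 'I_n -> box} -> int,
        x = \sum_(t | is_tableau t) polytabloid t *~ c t >].

Lemma spechtZ_zmod_closed : zmod_closed spechtZ_pred.
Proof.
split=> [|x y /asboolP[c ->] /asboolP[e ->]]; apply/asboolP.
  by exists (fun=> 0); rewrite big1 // => t _; rewrite mulr0z.
exists (fun t => c t - e t); rewrite -sumrB; apply: eq_bigr => t _.
by rewrite mulrzBr.
Qed.

HB.instance Definition _ :=
  GRing.isZmodClosed.Build permZ spechtZ_pred spechtZ_zmod_closed.

Record spechtZ := SpechtZ {
  spechtZ_val : permZ;
  spechtZ_valP : spechtZ_val \in spechtZ_pred
}.

HB.instance Definition _ := [isSub for spechtZ_val].
HB.instance Definition _ := [Choice of spechtZ by <:].
HB.instance Definition _ := [SubChoice_isSubZmodule of spechtZ by <:].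
HB.instance Definition _ :=
  GRing.isZmodMorphism.Build spechtZ permZ spechtZ_val (fun x y => erefl).

Lemma relabelM (T : finType) (s u : 'S_n) (f : {ffun 'I_n -> T}) :
  relabel s (relabel u f) = relabel (u * s)%g f.
Proof. by apply/ffunP=> i; rewrite !ffunE invMg permM. Qed.

Lemma relabel1 (T : finType) (f : {ffun 'I_n -> T}) : relabel 1%g f = f.
Proof. by apply/ffunP=> i; rewrite !ffunE invg1 perm1. Qed.

Lemma relabelK (T : finType) (s : 'S_n) : cancel (@relabel T s) (@relabel T s^-1).
Proof. by move=> f; rewrite relabelM mulgV relabel1. Qed.

Lemma relabelKV (T : finType) (s : 'S_n) : cancel (@relabel T s^-1) (@relabel T s).
Proof. by move=> f; rewrite relabelM mulVg relabel1. Qed.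

Lemma tableau_rows_relabel s t :
  tableau_rows (relabel s t) = relabel s (tableau_rows t).
Proof. by apply/ffunP=> i; rewrite !ffunE. Qed.

Lemma is_tableau_relabel s t : is_tableau (relabel s t) = is_tableau t.
Proof.
suff imp u f : is_tableau f -> is_tableau (relabel u f).
  by apply/idP/idP => /imp // /(_ s^-1%g); rewrite relabelK.
rewrite /is_tableau; case: d => // ab /andP[/injectiveP f_inj /forallP fP].
apply/andP; split.
  by apply/injectiveP=> i j; rewrite !ffunE => /f_inj/perm_inj.
apply/forallP=> x; rewrite -(eqP (fP x)); apply/eqP.
apply/codomP/codomP => -[i ->].
  by exists (u^-1%g i); rewrite ffunE.
by exists (u i); rewrite ffunE permK.
Qed.

Lemma column_stabilizer_relabel (s u : 'S_n) t :
  (u ^ s \in column_stabilizer (relabel s t))%g = (u \in column_stabilizer t).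
Proof.
rewrite !inE; apply/forallP/forallP => tP i.
  by move/(_ (s i)): tP; rewrite !ffunE !permM !permK.
rewrite !ffunE.
by move/(_ (s^-1%g i)): tP; rewrite !permM permK.
Qed.

Lemma permZ_act_polytabloid s t :
  permZ_act s (polytabloid t) = polytabloid (relabel s t).
Proof.
apply/ffunP=> T; rewrite !ffunE [RHS](reindex_inj (conjg_inj s)) /=.
apply: eq_big => [u|u _]; first by rewrite column_stabilizer_relabel.
rewrite odd_permJ relabelM -conjgC -relabelM; congr (_ *+ nat_of_bool _).
rewrite [in RHS]tableau_rows_relabel.
by rewrite -[in RHS](inj_eq (can_inj (@relabelK _ s^-1))) relabelK.
Qed.

Lemma permZ_act_zmod s : zmod_morphism (permZ_act s).
Proof. by move=> x y; apply/ffunP=> T; rewrite !ffunE. Qed.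

HB.instance Definition _ s :=
  GRing.isZmodMorphism.Build permZ permZ (permZ_act s) (permZ_act_zmod s).

Lemma spechtZ_stable s x : x \in spechtZ_pred -> permZ_act s x \in spechtZ_pred.
Proof.
move=> /asboolP[c ->]; apply/asboolP; exists (c \o relabel s^-1).
rewrite raddf_sum (reindex_inj (can_inj (@relabelKV box s))) /=.
apply: eq_big => [t|t _]; first by rewrite is_tableau_relabel.
by rewrite raddfMz /= permZ_act_polytabloid relabelKV.
Qed.

Definition spechtZ_act (s : 'S_n) (x : spechtZ) : spechtZ :=
  SpechtZ (spechtZ_stable s (spechtZ_valP x)).

Lemma spechtZ_act_zmod s : zmod_morphism (spechtZ_act s).
Proof. by move=> x y; apply: val_inj; rewrite /= raddfB. Qed.

HB.instance Definition _ s :=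
  GRing.isZmodMorphism.Build spechtZ spechtZ (spechtZ_act s) (spechtZ_act_zmod s).

(* The restriction of the form for which tabloids are orthonormal. *)
Definition spechtZ_form (x y : spechtZ) : int := \sum_T spechtZ_val x T * spechtZ_val y T.

Lemma spechtZ_formC x y : spechtZ_form x y = spechtZ_form y x.
Proof. by apply: eq_bigr => T _; rewrite mulrC. Qed.

Lemma spechtZ_formDl x y z :
  spechtZ_form (x + y) z = spechtZ_form x z + spechtZ_form y z.
Proof. by rewrite -big_split; apply: eq_bigr => T _; rewrite ffunE mulrDl. Qed.

Lemma spechtZ_formMn x y m : spechtZ_form (x *+ m) y = spechtZ_form x y *+ m.
Proof.
elim: m => [|m IH]; last by rewrite !mulrS spechtZ_formDl IH.
by rewrite !mulr0n /spechtZ_form big1 // => T _; rewrite ffunE mul0r.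
Qed.

Lemma tabloid_act1 T : tabloid_act 1%g T = T.
Proof. by apply: val_inj; apply: relabel1. Qed.

Lemma tabloid_actM s u T :
  tabloid_act s (tabloid_act u T) = tabloid_act (u * s)%g T.
Proof. by apply: val_inj; apply: relabelM. Qed.

Lemma tabloid_actK s : cancel (tabloid_act s) (tabloid_act s^-1).
Proof. by move=> T; apply: val_inj; apply: relabelK. Qed.

Lemma spechtZ_form_act s x y :
  spechtZ_form (spechtZ_act s x) (spechtZ_act s y) = spechtZ_form x y.
Proof.
rewrite /spechtZ_form (reindex_inj (can_inj (tabloid_actK s))).
by apply: eq_bigr => T _; rewrite /= !ffunE tabloid_actK.
Qed.

Lemma spechtZ_fg : finitely_generated spechtZ.
Proof.
pose tab := [set t | is_tableau t].
have poly_in t : t \in tab -> polytabloid t \in spechtZ_pred.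
  rewrite inE => tP; apply/asboolP; exists (fun u => (u == t)%:Z).
  rewrite (bigD1 t) //= eqxx big1 ?addr0 // => u /andP[_ /negPf->].
  by rewrite mulr0z.
exists #|tab|, (fun i => SpechtZ (poly_in _ (enum_valP i))) => x.
have /asboolP[c cP] := spechtZ_valP x.
exists (fun i => c (enum_val i)); apply: val_inj.
rewrite raddf_sum /= cP (eq_bigl (mem tab)) => [|t]; last by rewrite !inE.
rewrite big_enum_val; apply: eq_bigr => i _.
by rewrite raddfMz.
Qed.

Variables (p : nat) (p_pr : prime p).

Definition pspechtZ_pred : {pred spechtZ} := fun x => `[< exists y, x = y *+ p >].

Lemma pspechtZ_zmod_closed : zmod_closed pspechtZ_pred.
Proof.
split=> [|x y /asboolP[u ->] /asboolP[v ->]]; apply/asboolP.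
  by exists 0; rewrite mul0rn.
by exists (u - v); rewrite mulrnBl.
Qed.

HB.instance Definition _ :=
  GRing.isZmodClosed.Build spechtZ pspechtZ_pred pspechtZ_zmod_closed.

Lemma pspechtZ_mulrn x : x *+ p \in pspechtZ_pred.
Proof. by apply/asboolP; exists x. Qed.

(* The reduction modulo p of the integral Specht module, over 'F_p. *)
Definition specht : Type := pquot p_pr pspechtZ_mulrn spechtZ_fg.

HB.instance Definition _ :=
  Vector.copy specht (pquot p_pr pspechtZ_mulrn spechtZ_fg).
HB.instance Definition _ :=
  ZmodQuotient.copy specht (pquot p_pr pspechtZ_mulrn spechtZ_fg).

Lemma specht_pi_eq0 v : (\pi_specht v == 0) = (v \in pspechtZ_pred).
Proof. exact: (pquot_pi_eq0 p_pr pspechtZ_mulrn spechtZ_fg). Qed.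

Lemma specht_repr (v : spechtZ) : exists y, v = repr (\pi_specht v) + y *+ p.
Proof.
have /asboolP[y yP] : v - repr (\pi_specht v) \in pspechtZ_pred.
  by rewrite -specht_pi_eq0 raddfB /= reprK subrr.
by exists y; rewrite -yP addrC subrK.
Qed.

Definition specht_act (s : 'S_n) (x : specht) : specht :=
  \pi_specht (spechtZ_act s (repr x)).

Lemma specht_actE s v : specht_act s (\pi_specht v) = \pi_specht (spechtZ_act s v).
Proof.
have [y {2}->] := specht_repr v; apply/esym/eqP.
rewrite -subr_eq0 -raddfB -raddfB /= addrAC subrr add0r raddfMn /=.
by rewrite specht_pi_eq0 pspechtZ_mulrn.
Qed.

Lemma specht_act_zmod s : zmod_morphism (specht_act s).
Proof.
move=> x y; elim/quotW: x => x; elim/quotW: y => y.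
by rewrite -raddfB /= !specht_actE raddfB raddfB.
Qed.

HB.instance Definition _ s :=
  GRing.isZmodMorphism.Build specht specht (specht_act s) (specht_act_zmod s).

Lemma specht_act_scalable s : scalable (specht_act s).
Proof. by move=> k x; apply: (raddfMn (specht_act s)). Qed.

HB.instance Definition _ s :=
  GRing.isScalable.Build 'F_p specht specht _ (specht_act s) (specht_act_scalable s).

Definition specht_form (x y : specht) : 'F_p :=
  (spechtZ_form (repr x) (repr y))%:~R.

Lemma specht_formC x y : specht_form x y = specht_form y x.
Proof. by rewrite /specht_form spechtZ_formC. Qed.

Lemma spechtZ_form_repr v y :
  (spechtZ_form (repr (\pi_specht v)) y)%:~R = (spechtZ_form v y)%:~R :> 'F_p.
Proof.
have [u {2}->] := specht_repr v.
rewrite spechtZ_formDl spechtZ_formMn rmorphD rmorphMn /=.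
by rewrite -[X in _ + X]mulr_natr pchar_Fp_0 // mulr0 addr0.
Qed.

Lemma specht_formE v w :
  specht_form (\pi_specht v) (\pi_specht w) = (spechtZ_form v w)%:~R.
Proof. by rewrite /specht_form spechtZ_form_repr !(spechtZ_formC v) spechtZ_form_repr. Qed.

Lemma specht_form_act s x y :
  specht_form (specht_act s x) (specht_act s y) = specht_form x y.
Proof.
elim/quotW: x => x; elim/quotW: y => y.
by rewrite !specht_actE !specht_formE spechtZ_form_act.
Qed.

Definition radical : {pred specht} := fun x => `[< forall y, specht_form x y = 0 >].

Lemma radical_zmod_closed : zmod_closed radical.
Proof.
have formB x y z : specht_form (x - y) z = specht_form x z - specht_form y z.
  elim/quotW: x => x; elim/quotW: y => y; elim/quotW: z => z.
  rewrite -raddfB !specht_formE -rmorphB /=; congr (_%:~R).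
  by apply/eqP; rewrite eq_sym subr_eq -spechtZ_formDl subrK.
split=> [|x y /asboolP xR /asboolP yR]; apply/asboolP => z.
  by rewrite -(subrr 0) formB subrr.
by rewrite formB xR yR subrr.
Qed.

HB.instance Definition _ :=
  GRing.isZmodClosed.Build specht radical radical_zmod_closed.

Lemma radical_mulrn x : x *+ p \in radical.
Proof.
by rewrite [x *+ p](pquot_mulrp (x : pquot p_pr pspechtZ_mulrn spechtZ_fg)) rpred0.
Qed.

Lemma specht_fg : finitely_generated specht.
Proof. exact: (pquot_fg p_pr pspechtZ_mulrn spechtZ_fg). Qed.

(* The quotient of specht by the radical of its form. *)
Definition dmod : Type := pquot p_pr radical_mulrn specht_fg.

HB.instance Definition _ :=
  Vector.copy dmod (pquot p_pr radical_mulrn specht_fg).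
HB.instance Definition _ :=
  ZmodQuotient.copy dmod (pquot p_pr radical_mulrn specht_fg).

Lemma dmod_pi_eq0 v : (\pi_dmod v == 0) = (v \in radical).
Proof. exact: (pquot_pi_eq0 p_pr radical_mulrn specht_fg). Qed.

Definition dmod_act (s : 'S_n) (x : dmod) : dmod :=
  \pi_dmod (specht_act s (repr x)).

Lemma specht_act1 x : specht_act 1%g x = x.
Proof.
elim/quotW: x => x; rewrite specht_actE; congr (\pi_specht _).
apply: val_inj; apply/ffunP=> T; rewrite /= ffunE.
by rewrite invg1 tabloid_act1.
Qed.

Lemma specht_actM s u x : specht_act s (specht_act u x) = specht_act (u * s)%g x.
Proof.
elim/quotW: x => x; rewrite (specht_actE u) !specht_actE; congr (\pi_specht _).
apply: val_inj; apply/ffunP=> T; rewrite /= !ffunE.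
by rewrite tabloid_actM invMg.
Qed.

Lemma radical_stable s x : x \in radical -> specht_act s x \in radical.
Proof.
move=> /asboolP xR; apply/asboolP=> y.
by rewrite -[y]specht_act1 -(mulVg s) -specht_actM specht_form_act xR.
Qed.

Lemma dmod_actE s v : dmod_act s (\pi_dmod v) = \pi_dmod (specht_act s v).
Proof.
apply/eqP; rewrite -subr_eq0 -raddfB /= dmod_pi_eq0 -raddfB radical_stable //.
by rewrite -dmod_pi_eq0 raddfB /= reprK subrr.
Qed.

Lemma dmod_act_zmod s : zmod_morphism (dmod_act s).
Proof.
move=> x y; elim/quotW: x => x; elim/quotW: y => y.
by rewrite -raddfB /= !dmod_actE raddfB raddfB.
Qed.

HB.instance Definition _ s :=
  GRing.isZmodMorphism.Build dmod dmod (dmod_act s) (dmod_act_zmod s).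

Lemma dmod_act_scalable s : scalable (dmod_act s).
Proof. by move=> k x; apply: (raddfMn (dmod_act s)). Qed.

HB.instance Definition _ s :=
  GRing.isScalable.Build 'F_p dmod dmod _ (dmod_act s) (dmod_act_scalable s).

End Specht.

Definition lin_trace (F : fieldType) (V : vectType F) (f : {linear V -> V}) : F :=
  let e := vbasis {:V}%VS in \sum_(i < \dim {:V}) coord e i (f e`_i).

Definition specht_char p (p_pr : prime p) n (d : diagram) (s : 'S_n) : 'F_p :=
  lin_trace (@specht_act n d p p_pr s).

Definition dmod_char p (p_pr : prime p) n (d : diagram) (s : 'S_n) : 'F_p :=
  lin_trace (@dmod_act n d p p_pr s).

Definition mk_diagram (r1 r2 : int) : diagram :=
  if (0 <= r1) && (0 <= r2) then Some (`|r1|%N, `|r2|%N) else None.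

(* The j-th diagram is [a + ip, b - ip] for j = 2i, and
   [b + ip - 1, a - ip + 1] for j = 2i - 1. *)
Definition tau (p a b j : nat) : diagram :=
  if odd j then
    let i := j.+1./2 in
    mk_diagram (b%:Z + (i * p)%:Z - 1) (a%:Z - (i * p)%:Z + 1)
  else
    let i := j./2 in mk_diagram (a%:Z + (i * p)%:Z) (b%:Z - (i * p)%:Z).

Lemma tau_undefined p a b j :
  (3 <= p)%N -> (b <= a)%N -> (a + b < j)%N -> tau p a b j = None.
Proof.
move=> p3 ba abj; have ip i : (i * 3 <= i * p)%N by rewrite leq_mul2l p3 orbT.
rewrite /tau /mk_diagram; case: ifP => j_odd.
  have jE : j.+1 = (j.+1./2).*2 by rewrite -[LHS]odd_double_half /= j_odd.
  by case: ifP => // /andP[]; move: (ip j.+1./2); lia.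
have jE : j = (j./2).*2 by rewrite -[LHS]odd_double_half j_odd.
by case: ifP => // /andP[]; move: (ip j./2); lia.
Qed.

(* With tau_undefined, the two lemmas below show that specht n (tau p a b j) is
   zero, and has zero character, for large j. *)
Lemma specht_undefined p (p_pr : prime p) n (x : specht n None p_pr) : x = 0.
Proof.
elim/quotW: x => x; rewrite -(raddf0 (\pi_(specht n None p_pr))).
by congr (\pi_ _ _); apply: val_inj; apply/ffunP=> -[].
Qed.

Lemma specht_char_undefined p (p_pr : prime p) n s :
  specht_char p_pr (n := n) None s = 0.
Proof.
by apply: big1 => i _ /=; rewrite [specht_act _ _]specht_undefined linear0.
Qed.

(* Main.v *)
From HB Require Import structures.
Require Import Defs.
From mathcomp Require Import all_boot all_order all_fingroup all_algebra.
From mathcomp Require Import ssrAC generic_quotient boolp classical_sets fsbigop zify.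

Set Implicit Arguments.
Unset Strict Implicit.
Unset Printing Implicit Defensive.

Import Order.TTheory GRing.Theory Num.Theory.

Local Open Scope ring_scope.

(* Write [V] for the free module of rank 2. Tabloids with [n] boxes and at most
   two rows form the standard basis of the n-th tensor power of [V], on which
   sl_2 acts by [E] (move an entry to row 1) and [F] (move it to row 2). Over any
   ring, if [2c <= n], the polytabloids of shape [n - c, c] span the space of vectors
   of degree [c] killed by all divided powers of [E]. In particular the integral
   Specht lattice is pure, and its reduction mod p is the space [S n c] of such
   vectors over F_p.

   If [n - 2c + 1] is congruent to [k] mod p, with [0 <= k <= p], then [F^k] maps
   [S n c] to [S n (c + k)]; as [F^p = 0], alternating [F^k] and [F^(p-k)] gives
   the complex of the theorem. Exactness is proved by induction on [n], by
   splitting off the last tensor factor: the complex for [n] restricts to the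
   ones for [n - 1] with [k - 1] and [k + 1], the degenerate cases [k = 0] and
   [k = p] being trivially exact. The same induction identifies the image in
   degree 0 with the radical, since Specht modules in the range
   [a - b <= p - 2] split orthogonally under restriction. The character formula
   follows by additivity of traces along the finite resolution. *)

(** * The tensor power and its sl_2 action *)

(* [(x, y) : tens R n.+1] stands for the sum of [x] tensor row 1 and [y] tensor
   row 2, the last factor recording the row of the entry [n]. *)
Fixpoint tens (R : comNzRingType) (n : nat) : lmodType R :=
  if n is m.+1 then ((tens R m * tens R m)%type : lmodType R) else (R^o : lmodType R).

Fixpoint lower_rec (R : comNzRingType) (n i : nat) : tens R n -> tens R n :=
  match n return tens R n -> tens R n with
  | 0 => fun v => if i == 0%N then v else 0
  | m.+1 => fun v =>
      (lower_rec i v.1 + (if i is j.+1 then lower_rec j v.2 else 0), lower_rec i v.2)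
  end.

Fixpoint raise_rec (R : comNzRingType) (n : nat) : tens R n -> tens R n :=
  match n return tens R n -> tens R n with
  | 0 => fun v => 0
  | m.+1 => fun v => (raise_rec v.1, raise_rec v.2 + v.1)
  end.

Fixpoint gr_rec (R : comNzRingType) (n : nat) (c : int) : tens R n -> tens R n :=
  match n return tens R n -> tens R n with
  | 0 => fun v => if c == 0 then v else 0
  | m.+1 => fun v => (gr_rec c v.1, gr_rec (c - 1) v.2)
  end.

Fixpoint dotp_rec (R : comNzRingType) (n : nat) : tens R n -> tens R n -> R :=
  match n return tens R n -> tens R n -> R with
  | 0 => fun v w => v * w
  | m.+1 => fun v w => dotp_rec v.1 w.1 + dotp_rec v.2 w.2
  end.

(* [lower i] is the divided power [E^i / i!], [raise] is [F], and [gr c] projects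
   onto the span of the tabloids with [c] entries in row 2. *)
HB.lock Definition lower (R : comNzRingType) (n i : nat) (v : tens R n) := lower_rec i v.
HB.lock Definition raise (R : comNzRingType) (n : nat) (v : tens R n) := raise_rec v.
HB.lock Definition gr (R : comNzRingType) (n : nat) (c : int) (v : tens R n) := gr_rec c v.
HB.lock Definition dotp (R : comNzRingType) (n : nat) (v w : tens R n) := dotp_rec v w.
Arguments lower {R n}.
Arguments raise {R n}.
Arguments gr {R n}.
Arguments dotp {R n}.

Section TensorPower.

Variable R : comNzRingType.
Local Notation tens := (tens R).
Implicit Types (c : int).

Lemma tens_ind n (P : tens n.+1 -> Prop) :
  (forall x y : tens n, P (x, y)) -> forall v, P v.
Proof. by move=> Pxy [x y]; apply: Pxy. Qed.

Lemma lower_nil i (v : tens 0) : lower i v = if i == 0%N then v else 0.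
Proof. by rewrite lower.unlock. Qed.

Lemma raise_nil (v : tens 0) : raise v = 0.
Proof. by rewrite raise.unlock. Qed.

Lemma gr_nil c (v : tens 0) : gr c v = if c == 0 then v else 0.
Proof. by rewrite gr.unlock. Qed.

Lemma dotp_nil (v w : tens 0) : dotp v w = (v : R) * (w : R).
Proof. by rewrite dotp.unlock. Qed.

Lemma lower_pair n i (x y : tens n) : lower i ((x, y) : tens n.+1) =
  (lower i x + (if i is j.+1 then lower j y else 0), lower i y).
Proof. by rewrite lower.unlock. Qed.

Lemma raise_pair n (x y : tens n) :
  raise ((x, y) : tens n.+1) = (raise x, raise y + x).
Proof. by rewrite raise.unlock. Qed.

Lemma gr_pair n c (x y : tens n) :
  gr c ((x, y) : tens n.+1) = (gr c x, gr (c - 1) y).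
Proof. by rewrite gr.unlock. Qed.

Lemma dotp_pair n (x y x' y' : tens n) :
  dotp ((x, y) : tens n.+1) ((x', y') : tens n.+1) = dotp x x' + dotp y y'.
Proof. by rewrite dotp.unlock. Qed.

Lemma pair_add n (x y x' y' : tens n) :
  ((x, y) : tens n.+1) + ((x', y') : tens n.+1) = (x + x', y + y').
Proof. by []. Qed.

Lemma pair_opp n (x y : tens n) : - ((x, y) : tens n.+1) = (- x, - y).
Proof. by []. Qed.

Lemma pair_scale n k (x y : tens n) :
  k *: ((x, y) : tens n.+1) = (k *: x, k *: y).
Proof. by []. Qed.

Lemma pair_mulrn n k (x y : tens n) :
  ((x, y) : tens n.+1) *+ k = (x *+ k, y *+ k).
Proof. by rewrite -scaler_nat -[x *+ k]scaler_nat -[y *+ k]scaler_nat. Qed.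

Definition pairE := (lower_pair, raise_pair, gr_pair, dotp_pair,
  pair_add, pair_opp, pair_scale, pair_mulrn).

Lemma lower_linear n i : linear (@lower R n i).
Proof.
elim: n i => [|n IH] i k.
  by move=> u v; rewrite !lower_nil; case: ifP => // _; rewrite scaler0 addr0.
elim/tens_ind=> x y; elim/tens_ind=> x' y'; rewrite !pairE !IH; congr (_, _).
by case: i => [|i]; rewrite ?addr0 // IH scalerDr addrACA.
Qed.
HB.instance Definition _ n i :=
  GRing.isLinear.Build R (tens n) (tens n) _ (@lower R n i) (@lower_linear n i).

Lemma raise_linear n : linear (@raise R n).
Proof.
elim: n => [|n IH] k; first by move=> u v; rewrite !raise_nil scaler0 addr0.
elim/tens_ind=> x y; elim/tens_ind=> x' y'; rewrite !pairE !IH; congr (_, _).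
by rewrite scalerDr addrACA.
Qed.
HB.instance Definition _ n :=
  GRing.isLinear.Build R (tens n) (tens n) _ (@raise R n) (@raise_linear n).

Lemma gr_linear n c : linear (@gr R n c).
Proof.
elim: n c => [|n IH] c k.
  by move=> u v; rewrite !gr_nil; case: ifP => // _; rewrite scaler0 addr0.
by elim/tens_ind=> x y; elim/tens_ind=> x' y'; rewrite !pairE !IH.
Qed.
HB.instance Definition _ n c :=
  GRing.isLinear.Build R (tens n) (tens n) _ (@gr R n c) (@gr_linear n c).

Lemma lower0 n (v : tens n) : lower 0 v = v.
Proof.
elim: n v => [|n IH]; first by move=> v; rewrite lower_nil.
by elim/tens_ind=> x y; rewrite pairE !IH addr0.
Qed.

Lemma lower_gt n i (v : tens n) : (n < i)%N -> lower i v = 0.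
Proof.
elim: n i v => [|n IH] [|i] //; first by move=> v; rewrite lower_nil.
elim/tens_ind=> x y ni.
by rewrite pairE !IH ?addr0 //; lia.
Qed.

Lemma lowerS n i (v : tens n) : lower i.+1 v *+ i.+1 = lower 1 (lower i v).
Proof.
elim: n i v => [|n IH] i; first by move=> v; rewrite !lower_nil mul0rn.
elim/tens_ind=> x y; rewrite !pairE; congr (_, _); last by rewrite IH.
rewrite mulrnDl IH linearD /= lower0 -addrA; congr (_ + _).
by case: i => [|i]; rewrite ?linear0 ?lower0 ?add0r // mulrSr IH.
Qed.

Lemma gr_raise n c (v : tens n) : gr c (raise v) = raise (gr (c - 1) v).
Proof.
elim: n c v => [|n IH] c; first by move=> v; rewrite !raise_nil gr_nil if_same.
by elim/tens_ind=> x y; rewrite !pairE linearD /= !IH.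
Qed.

Definition homog n c (v : tens n) := gr c v = v.

Lemma homog0 n c : homog c (0 : tens n).
Proof. exact: linear0. Qed.

Lemma homogD n c (v w : tens n) : homog c v -> homog c w -> homog c (v + w).
Proof. by rewrite /homog linearD /= => -> ->. Qed.

Lemma homogZ n c k (v : tens n) : homog c v -> homog c (k *: v).
Proof. by rewrite /homog linearZ /= => ->. Qed.

Lemma homog_pairP n c (x y : tens n) : homog c ((x, y) : tens n.+1) <-> homog c x /\ homog (c - 1) y.
Proof. by rewrite /homog pairE; split=> [[]|[-> ->]]. Qed.

Lemma homog_raise n c (v : tens n) : homog c v -> homog (c + 1) (raise v).
Proof. by rewrite /homog gr_raise addrK => ->. Qed.

Lemma homog_raisek n c k (v : tens n) : homog c v -> homog (c + k%:Z) (iter k (@raise R n) v).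
Proof.
move=> vc; elim: k => [|k IH] /=; first by rewrite addr0.
have -> : c + k.+1%:Z = c + k%:Z + 1 by lia.
exact: homog_raise.
Qed.

Lemma homog_lt0 n c (v : tens n) : c < 0 -> homog c v -> v = 0.
Proof.
elim: n c v => [|n IH] c v c0; first by rewrite /homog gr_nil; case: eqP c0 => // ->.
by elim/tens_ind: v => x y /homog_pairP[xc yc]; rewrite (IH _ _ c0 xc) (IH _ _ _ yc) //; lia.
Qed.

(** The commutation relation of [E^(i+1)/(i+1)!] with [F], where [H = [E, F]] acts on degree [c] by
    [n - 2c]. Induction on the last tensor factor, whose contributions shift the scalar by 1. *)
Lemma lower_raise n c i (v : tens n) : homog c v ->
  lower i.+1 (raise v) = raise (lower i.+1 v) + (n%:Z - 2 * c + i%:Z)%:~R *: lower i v.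
Proof.
elim: n c i v => [|n IH] c i v.
  rewrite /homog gr_nil !lower_nil !raise_nil; case: eqP => [->|_ <-] /=.
    by case: i => [|i] _; rewrite ?(scaler0, mulr0, subr0, addr0, scale0r).
  by rewrite if_same scaler0 addr0.
elim/tens_ind: v => x y /homog_pairP[xc yc]; rewrite !pairE; congr (_, _).
  have Ey : lower i (raise y) = raise (lower i y) +
      (n.+1%:Z - 2 * c + i%:Z)%:~R *: (if i is j.+1 then lower j y else 0).
    case: i => [|i]; first by rewrite !lower0 scaler0 addr0.
    by rewrite (IH _ _ _ yc); congr (_ + _%:~R *: _); lia.
  have Ex : (n.+1%:Z - 2 * c + i%:Z)%:~R *: lower i x =
    (n%:Z - 2 * c + i%:Z)%:~R *: lower i x + lower i x.
    by rewrite [RHS]addrC -{2}[lower i x]scale1r -scalerDl -(intrD R 1); congr (_%:~R *: _); lia.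
  rewrite (IH _ _ _ xc) !linearD /= Ey Ex !addrA.
  by rewrite [LHS](ACl (1*3*2*5*4))%AC.
rewrite !linearD /= (IH _ _ _ yc).
have -> : n%:Z - 2 * (c - 1) + i%:Z = (n.+1%:Z - 2 * c + i%:Z) + 1 by lia.
rewrite intrD scalerDl scale1r !addrA.
by rewrite [LHS](ACl (1*4*3*2))%AC.
Qed.

Lemma dotpDl n (u v w : tens n) : dotp (u + v) w = dotp u w + dotp v w.
Proof.
elim: n u v w => [|n IH]; first by move=> u v w; rewrite !dotp_nil; apply: mulrDl.
by do 3!elim/tens_ind=> ? ?; rewrite !pairE !IH addrACA.
Qed.

Lemma dotpZl n k (u w : tens n) : dotp (k *: u) w = k * dotp u w.
Proof.
elim: n u w => [|n IH]; first by move=> u w; rewrite !dotp_nil mulrA.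
by do 2!elim/tens_ind=> ? ?; rewrite !pairE !IH mulrDr.
Qed.

Lemma dotpC n (v w : tens n) : dotp v w = dotp w v.
Proof.
elim: n v w => [|n IH]; first by move=> u w; rewrite !dotp_nil mulrC.
by do 2!elim/tens_ind=> ? ?; rewrite !pairE; congr (_ + _); apply: IH.
Qed.

Lemma dotp0l n (w : tens n) : dotp 0 w = 0.
Proof. by rewrite -(scale0r (0 : tens n)) dotpZl mul0r. Qed.

Lemma dotp_raise n (v w : tens n) : dotp (raise v) w = dotp v (lower 1 w).
Proof.
elim: n v w => [|n IH].
  by move=> v w; rewrite raise_nil lower_nil /= dotp0l [RHS]dotpC dotp0l.
elim/tens_ind=> x y; elim/tens_ind=> x' y'; rewrite !pairE lower0 dotpDl !IH.
by rewrite [in RHS]dotpC dotpDl ![dotp _ x]dotpC -!addrA [dotp y _ + _]addrC.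
Qed.

(** All divided powers are imposed: mod p, [lower 1 v = 0] only controls [lower i v] for [i < p]
    (see [lower_eq0]). *)
Definition killed n (v : tens n) := forall i, lower i.+1 v = 0.

Definition hw n c (v : tens n) := homog c v /\ killed v.

Lemma hw0 n c : hw c (0 : tens n).
Proof. by split=> [|i]; [apply: homog0 | apply: linear0]. Qed.

Lemma hwD n c (v w : tens n) : hw c v -> hw c w -> hw c (v + w).
Proof.
by move=> [vc v0] [wc w0]; split=> [|i]; [apply: homogD | rewrite linearD /= v0 w0 addr0].
Qed.

Lemma hwZ n c k (v : tens n) : hw c v -> hw c (k *: v).
Proof.
by move=> [vc v0]; split=> [|i]; [apply: homogZ | rewrite linearZ /= v0 scaler0].
Qed.

Lemma hwN n c (v : tens n) : hw c v -> hw c (- v).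
Proof. by rewrite -scaleN1r; apply: hwZ. Qed.

(** Branching: the second component is again a highest weight vector, and by [hw_pair0P] those with
    second component 0 are the ones of degree [c] on [n] factors. The inductions of [hw_exact] and
    [poly_span_hw] run along this filtration. *)
Lemma hw_pairP n c (x y : tens n) : hw c ((x, y) : tens n.+1) <->
  [/\ homog c x, hw (c - 1) y, lower 1 x = - y & forall i, lower i.+2 x = 0].
Proof.
split=> [[/homog_pairP[xc yc] k]|[xc [yc y0] x1 x2]].
  have kE i : lower i.+1 x + lower i y = 0 /\ lower i.+1 y = 0.
    by move: (k i); rewrite pairE => -[].
  have y0 : killed y by move=> i; case: (kE i).
  split=> // [|i].
    by apply/eqP; rewrite -addr_eq0; case: (kE 0%N); rewrite lower0 => ->.
  by case: (kE i.+1); rewrite y0 addr0.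
split=> [|[|i]]; first exact/homog_pairP.
  by rewrite pairE y0 lower0 x1 addNr.
by rewrite pairE !y0 x2 addr0.
Qed.

Lemma hw_pair0P n c (x : tens n) : hw c ((x, 0) : tens n.+1) <-> hw c x.
Proof.
split=> [/hw_pairP[xc _ x1 x2]|[xc x0]].
  by split=> // -[|i]; rewrite ?x1 ?oppr0 ?x2.
by apply/hw_pairP; split=> //; [apply: hw0 | rewrite oppr0].
Qed.

Lemma iter_raise_linear n k : linear (iter k (@raise R n)).
Proof. by elim: k => [|k IH] a u v //=; rewrite IH linearP. Qed.
HB.instance Definition _ n k :=
  GRing.isLinear.Build R (tens n) (tens n) _ (iter k (@raise R n)) (@iter_raise_linear n k).

(** On a single factor [F] squares to zero, so the binomial expansion of [F^k] stops after two
    terms. *)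
Lemma iter_raiseE n k (x y : tens n) :
  iter k (@raise R n.+1) (x, y) =
  (iter k (@raise R n) x, iter k (@raise R n) y + iter k.-1 (@raise R n) x *+ k).
Proof.
elim: k => [|k IH] /=; first by rewrite addr0.
rewrite IH pairE; congr (_, _); rewrite linearD /= -addrA; congr (_ + _).
case: k {IH} => [|k] /=; first by rewrite mulr1n raddf0 add0r.
by rewrite raddfMn /= [in RHS]mulrSr.
Qed.

Lemma dotp_iter_raise n k (v w : tens n) :
  killed w -> dotp (iter k.+1 (@raise R n) v) w = 0.
Proof. by move=> w0; rewrite /= dotp_raise w0 dotpC dotp0l. Qed.

(** The sl_2 string formula. Its coefficient vanishes mod p when [j.+1] is congruent to
    [n - 2c + 1]. *)
Lemma lower_iter_raise n c j (v : tens n) : hw c v ->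
  lower 1 (iter j.+1 (@raise R n) v) =
  (j.+1%:Z * (n%:Z - 2 * c - j%:Z))%:~R *: iter j (@raise R n) v.
Proof.
move=> [vc v0]; elim: j => [|j IH].
  rewrite /= (lower_raise _ vc) v0 raddf0 add0r lower0.
  by congr (_%:~R *: _); lia.
rewrite iterS (lower_raise _ (homog_raisek j.+1 vc)) IH linearZ /= lower0.
by rewrite -scalerDl -intrD; congr (_%:~R *: _); lia.
Qed.

Lemma lower_iter_raise_gt n c i j (v : tens n) : hw c v -> (j < i)%N ->
  lower i (iter j (@raise R n) v) = 0.
Proof.
move=> [vc v0]; elim: j i => [|j IH] [|i] // ji.
rewrite iterS (lower_raise _ (homog_raisek j vc)) !IH //; last by lia.
by rewrite raddf0 scaler0 addr0.
Qed.

End TensorPower.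

(** * Vanishing below the middle weight *)

(** Identify a tabloid with the set of entries in its row 2. The coefficient of the result at [T] is
    the sum of [(-1)^|U|] times the coefficient of [v] at [U], over the subsets [U] of [T]. *)
Fixpoint altsum_rec (R : comNzRingType) (n : nat) : tens R n -> tens R n :=
  match n return tens R n -> tens R n with
  | 0 => id
  | m.+1 => fun v => (altsum_rec v.1, altsum_rec v.1 - altsum_rec v.2)
  end.

HB.lock Definition altsum (R : comNzRingType) (n : nat) (v : tens R n) := altsum_rec v.
Arguments altsum {R n}.

Section Vanishing.

Variable R : comNzRingType.
Local Notation tens := (tens R).
Implicit Types (c d : int).

Lemma altsum_pair n (x y : tens n) :
  altsum ((x, y) : tens n.+1) = (altsum x, altsum x - altsum y).
Proof. by rewrite altsum.unlock. Qed.

Lemma altsumD n (v w : tens n) : altsum (v + w) = altsum v + altsum w.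
Proof.
elim: n v w => [|n IH]; first by rewrite altsum.unlock.
elim/tens_ind=> x y; elim/tens_ind=> x' y'.
by rewrite !(pairE, altsum_pair) !IH opprD addrACA.
Qed.

(** The exponential of [E]: its coefficient at [T] sums those of [v] over the supersets of [T]. *)
Definition zeta n (v : tens n) : tens n := \sum_(i < n.+1) lower i v.

Lemma zeta_pair n (x y : tens n) :
  zeta ((x, y) : tens n.+1) = (zeta x + zeta y, zeta y).
Proof.
have E (I : finType) (f g : I -> tens n) : \sum_i ((f i, g i) : tens n.+1) =
    (\sum_i f i, \sum_i g i).
  by elim/big_rec3: _ => // i a b [a' b'] _ [-> ->].
have zE (z : tens n) : \sum_(i < n.+2) lower i z = zeta z.
  by rewrite big_ord_recr /= (lower_gt z (leqnn _)) addr0.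
rewrite /zeta; under eq_bigr do rewrite lower_pair.
rewrite E big_split /= !zE.
by congr (_ + _, _); rewrite big_ord_recl add0r.
Qed.

Lemma zeta_killed n (v : tens n) : killed v -> zeta v = v.
Proof.
move=> v0; rewrite /zeta big_ord_recl lower0 big1 ?addr0 // => i _.
exact: v0.
Qed.

(* Moebius inversion turns the sum over supersets into a sum over disjoint
   sets, which have at most [n - c] elements. *)
Lemma gr_altsum_zeta n c d (v : tens n) : homog c v -> n%:Z - c < d ->
  gr d (altsum (zeta v)) = 0.
Proof.
elim: n c d v => [|n IH] c d v.
  rewrite /homog /zeta big_ord1 lower0 altsum.unlock /= !gr_nil.
  case: eqP => [->|_ <-]; last by rewrite if_same.
  by case: eqP => // ->; rewrite subrr ltxx.
elim/tens_ind: v => x y /homog_pairP[xc yc] cd.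
rewrite zeta_pair altsum_pair altsumD addrK pairE linearD /=.
by rewrite !(IH _ _ _ xc) ?(IH _ _ _ yc) ?addr0 //; lia.
Qed.

Lemma gr_altsum n c d (v : tens n) : homog c v -> d < c -> gr d (altsum v) = 0.
Proof.
elim: n c d v => [|n IH] c d v.
  rewrite /homog altsum.unlock /= !gr_nil.
  case: eqP => [->|_ <-]; last by rewrite if_same.
  by case: eqP => // ->; rewrite ltxx.
elim/tens_ind: v => x y /homog_pairP[xc yc] dc; rewrite altsum_pair pairE raddfB /=.
by rewrite !(IH _ _ _ xc) ?(IH _ _ _ yc) ?subr0 //; lia.
Qed.

(** A set of size [c] has only itself as a subset of size [c], so the degree [c] part of [altsum v]
    is [v] up to the sign [(-1)^c]. *)
Lemma gr_altsum_eq0 n c (v : tens n) : homog c v -> gr c (altsum v) = 0 -> v = 0.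
Proof.
elim: n c v => [|n IH] c v.
  by rewrite /homog altsum.unlock /= !gr_nil; case: eqP => // _ <-.
elim/tens_ind: v => x y /homog_pairP[xc yc]; rewrite altsum_pair pairE raddfB /=.
rewrite (@gr_altsum _ c (c - 1) x) //; last by lia.
by move=> [/(IH _ _ xc)-> /eqP]; rewrite sub0r oppr_eq0 => /eqP/(IH _ _ yc)->.
Qed.

(** Here [zeta v = v], so [altsum v] has no part in degrees above [n - c]; now [c] is such a
    degree. *)
Lemma hw_vanish n c (v : tens n) : n%:Z < 2 * c -> hw c v -> v = 0.
Proof.
move=> nc [vc v0]; apply: (gr_altsum_eq0 vc).
by rewrite -(zeta_killed v0) (gr_altsum_zeta vc) //; lia.
Qed.

End Vanishing.

(** * Exactness in characteristic p *)

Section CharP.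

Variables (F : fieldType) (p : nat).
Hypothesis pF : p \in [pchar F].
Local Notation tens := (tens F).
Implicit Types (c : int).

Lemma pchar_mulrn_tens n (v : tens n) : v *+ p = 0.
Proof. by rewrite -scaler_nat (pcharf0 pF) scale0r. Qed.

Lemma pchar_intr_eq0 (m : int) : (m * p%:Z)%:~R = 0 :> F.
Proof. by rewrite intrM -pmulrn (pcharf0 pF) mulr0. Qed.

Lemma pchar_natr_neq0 k : (0 < k < p)%N -> k%:R != 0 :> F.
Proof.
move=> kp; rewrite -(dvdn_pcharf pF); apply/negP => /dvdn_leq; lia.
Qed.

Lemma iter_raise_pchar n (v : tens n) : iter p (@raise F n) v = 0.
Proof.
have := pcharf_prime pF; case: p pF => // q qF _.
elim: n v => [|n IH]; first by move=> v; rewrite /= raise_nil.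
elim/tens_ind=> x y; rewrite iter_raiseE !IH add0r -scaler_nat.
by rewrite (pcharf0 qF) scale0r.
Qed.

(** For [i < p] the factorial of [i] is invertible, so the divided power is a multiple of [E^i]. *)
Lemma lower_eq0 n i (v : tens n) : lower 1 v = 0 -> (0 < i < p)%N -> lower i v = 0.
Proof.
move=> v1; elim: i => // i IH ip; apply/eqP.
have : lower i.+1 v *+ i.+1 == 0.
  by rewrite lowerS; case: i IH ip => [|i] IH ip; rewrite ?lower0 ?v1 // IH ?linear0 //; lia.
by rewrite -scaler_nat scaler_eq0 (negPf (pchar_natr_neq0 ip)).
Qed.

(** For [k < p] the congruence makes the string coefficient vanish, so [E] kills [F^k v]. Divided
    powers of order at most [k] then follow from [lower_eq0], and those of order above [k] exceed
    the length of the string. *)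
Lemma hw_iter_raise n c k (m : int) (v : tens n) : hw c v -> (k <= p)%N ->
  n%:Z - 2 * c + 1 = k%:Z + m * p%:Z -> hw (c + k%:Z) (iter k (@raise F n) v).
Proof.
move=> vS; rewrite leq_eqVlt => /orP[/eqP-> _|kp cE].
  by rewrite iter_raise_pchar; apply: hw0.
have w1 : lower 1 (iter k (@raise F n) v) = 0.
  case: k kp cE => [|k] kp cE; first by case: vS => _ ->.
  have -> := lower_iter_raise k vS.
  suff -> : k.+1%:Z * (n%:Z - 2 * c - k%:Z) = (k.+1%:Z * m) * p%:Z.
    by rewrite pchar_intr_eq0 scale0r.
  by rewrite -mulrA; congr (_ * _); lia.
split=> [|i]; first by apply: homog_raisek; case: vS.
have [ik|ki] := leqP i.+1 k; first by apply: lower_eq0 => //; lia.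
exact: (lower_iter_raise_gt vS).
Qed.

(* [q = 0] is the end of the complex, where the cocycle condition is replaced
   by orthogonality; the maps for [k = 0] and [k = p] are [id] and [0]. *)
Lemma hw_exact n c k q (v : tens n) : (k <= p)%N ->
  n%:Z - 2 * c + 1 = k%:Z + q%:Z * p%:Z -> hw c v ->
  (q = 0%N -> (k < p)%N -> forall w : tens n, hw c w -> dotp v w = 0) ->
  ((0 < q)%N -> iter k (@raise F n) v = 0) ->
  exists2 u : tens n, hw (c - (p - k)%N%:Z) u & v = iter (p - k) (@raise F n) u.
Proof.
have p_gt1 := prime_gt1 (pcharf_prime pF).
elim: n c k v => [|n IH] c k v kp cE vS vq vk.
all: move: kp; rewrite leq_eqVlt => /orP[/eqP kE|kp].
1,3: by rewrite kE subnn subr0; exists v.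
(* For [k = 0] the vector is 0: if [q = 0] then [n < 2c] and [hw_vanish] applies, otherwise the
   cocycle condition reads [v = 0]. *)
all: have [k0|k_gt0] := posnP k.
1,3: exists 0; rewrite ?linear0; first exact: hw0.
1,2: have [q0|/vk] := posnP q; last by rewrite k0.
1,2: by apply: (hw_vanish _ vS); lia.
  (* With no factors only degree 0 survives; this forces [q = 0] and [k = 1], and orthogonality to
     the vector 1 gives [v = 0]. *)
  have v0 : v = 0.
    have [c0|/eqP c0] := eqVneq c 0; last first.
      by case: vS => vc _; move: vc; rewrite /homog gr_nil; case: eqP => // _ <-.
    have q0 : q = 0%N by nia.
    have := vq q0 kp (1 : F); rewrite dotp_nil mulr1; apply.
    split=> [|i]; first by rewrite /homog gr_nil c0.
    by rewrite lower_nil.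
  by exists 0; [apply: hw0 | rewrite linear0].
have kn0 : k%:R != 0 :> F by apply: pchar_natr_neq0; lia.
have rn0 : (p - k)%N%:R != 0 :> F by apply: pchar_natr_neq0; lia.
have prE : (p - k)%N%:R = - k%:R :> F.
  by rewrite natrB 1?ltnW // (pcharf0 pF) sub0r.
(* The second component of [v] is a solution one step closer to [k = p]. For
   [q = 0] it is orthogonal to every [w] because [(- F w / k, w)] lifts [w] to a
   highest weight vector. *)
have [z zS vE] : exists2 z : tens n, hw (c - (p - k)%N%:Z) z &
    v.2 = iter (p - k).-1 (@raise F n) z.
  move: vS vq vk; elim/tens_ind: v => x y /= /hw_pairP[xc yS xy x2] vq vk.
  have [|||||z zS ->] := IH (c - 1) k.+1 y; rewrite ?kp //; first by lia.
  - move=> q0 kp1 w wS.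
    have [wc w0] := wS.
    have k1n0 : k.+1%:R != 0 :> F by apply: pchar_natr_neq0; lia.
    have w'S : hw c ((- k%:R^-1 *: raise w, w) : tens n.+1).
      apply/hw_pairP; split=> // [||i].
      - apply: homogZ; rewrite -[c](subrK 1); exact: homog_raise.
      - rewrite linearZ /= (lower_raise _ wc) w0 raddf0 add0r lower0 scalerA.
        have -> : n%:Z - 2 * (c - 1) + 0%:Z = k%:Z by lia.
        by rewrite mulNr mulVf // scaleN1r.
      - by rewrite linearZ /= (lower_raise _ wc) !w0 raddf0 add0r !scaler0.
    (* Since [E x = - y], this pairing equals [(1 + 1/k)] times [dotp y w], and [k + 1] is
       invertible mod p. *)
    have := vq q0 (ltnW kp1) _ w'S; rewrite dotp_pair dotpC dotpZl dotp_raise xy.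
    rewrite [dotp w _]dotpC -scaleN1r dotpZl mulN1r mulrNN => /eqP.
    rewrite -[X in _ + X]mul1r -mulrDl mulf_eq0 => /orP[|/eqP//].
    rewrite -[X in _ + X](mulVf kn0) -{1}[k%:R^-1]mulr1 -mulrDr mulf_eq0 invr_eq0 (negPf kn0) /=.
    by rewrite addrC natr1 (negPf k1n0).
  (* The first component gives [F^k x = 0]; applying [F] to the second one leaves
     [F^(k+1) y = 0]. *)
  - move=> q_gt0; have := vk q_gt0; rewrite iter_raiseE => -[xk].
    move: k_gt0 xk; case: (k) => // j _ /= xk /(congr1 (@raise F n)).
    by rewrite linear0 linearD /= raddfMn /= xk mul0rn addr0.
  exists z; last by rewrite subnS.
  by move: zS; congr (hw _ _); lia.
(* Subtracting the image of [u'] kills the second component. *)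
pose u' : tens n.+1 := ((p - k)%N%:R^-1 *: z, 0).
have u'S : hw (c - (p - k)%N%:Z) u' by apply/hw_pair0P; apply: hwZ.
have cE' : n.+1%:Z - 2 * (c - (p - k)%N%:Z) + 1 = (p - k)%N%:Z + q.+1%:Z * p%:Z by lia.
pose v' := v - iter (p - k) (@raise F n.+1) u'.
have v'S : hw c v'.
  apply: hwD => //; apply: hwN.
  have := hw_iter_raise u'S (leq_subr _ _) cE'; congr (hw _ _); lia.
have v'E : v'.2 = 0.
  rewrite /v' /u' iter_raiseE linear0 add0r /= linearZ /=.
  rewrite -[(_ *: _) *+ _]scaler_nat scalerA mulfV //.
  by rewrite scale1r -vE; case: (v) => x y /=; rewrite subrr.
have v'q : q = 0%N -> forall w : tens n.+1, hw c w -> dotp v' w = 0.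
  move=> q0 w wS; rewrite dotpDl vq // -scaleN1r dotpZl.
  have [r rE] : exists r, (p - k)%N = r.+1 by exists (p - k).-1; lia.
  by case: wS => _ w0; rewrite rE dotp_iter_raise // mulr0 addr0.
have v'k : (0 < q)%N -> iter k (@raise F n.+1) v' = 0.
  move=> q_gt0; rewrite /v' linearB /= vk // -iterD subnKC 1?ltnW //.
  by rewrite (@iter_raise_pchar n.+1) subr0.
suff [u uS uE] : exists2 u : tens n.+1, hw (c - (p - k)%N%:Z) u &
    v' = iter (p - k) (@raise F n.+1) u.
  by exists (u' + u); [apply: hwD | rewrite linearD /= -uE /v' addrC subrK].
move: v' v'S v'E v'q v'k => v'; elim/tens_ind: v' => x y vS' /= y0.
rewrite {}y0 in vS' *; move/hw_pair0P: vS' => xS v'q v'k.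
(* What remains is the first component, a problem for [n] factors one step closer to [k = 0]. *)
have [|||||z' zS' ->] := IH c k.-1 x; rewrite ?xS //; try lia.
- move=> q0 _ w /hw_pair0P wS; have := v'q q0 _ wS.
  by rewrite dotp_pair dotp0l addr0.
- move=> q_gt0; have := v'k q_gt0; rewrite iter_raiseE => -[_].
  rewrite linear0 add0r -scaler_nat => /eqP; rewrite scaler_eq0 (negPf kn0).
  by move/eqP.
(* The coefficient [k] serves twice: [E F z' = - k z'] mod p makes the pair a highest weight vector,
   and [F^(p-k)] of the pair has second component [(k + (p - k)) F^(p-k) z' = 0]. *)
exists (raise z', k%:R *: z').
  have zS1 : hw (c - (p - k)%N%:Z - 1) z' by move: zS'; congr (hw _ _); lia.
  have [zc z0] := zS1.
  apply/hw_pairP; split=> [|||i]; last 1 first.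
  - by rewrite (lower_raise _ zc) !z0 raddf0 add0r scaler0.
  - by rewrite -[c - _](subrK 1); apply: homog_raise.
  - exact: hwZ.
  - rewrite (lower_raise _ zc) z0 raddf0 add0r lower0 -scaleNr; congr (_ *: _).
    have -> : n%:Z - 2 * (c - (p - k)%N%:Z - 1) + 0%:Z = q.+2%:Z * p%:Z - k%:Z by lia.
    by rewrite intrB pchar_intr_eq0 sub0r.
rewrite iter_raiseE; congr (_, _).
  by rewrite -iterSr; congr (iter _ _ _); lia.
rewrite -iterSr; have -> : (p - k).-1.+1 = (p - k)%N by lia.
by rewrite linearZ /= -[iter _ _ _ *+ _]scaler_nat -scalerDl prE subrr scale0r.
Qed.

End CharP.

(** * Generation by polytabloids *)

Fixpoint swp_rec (R : comNzRingType) (n j : nat) : tens R n -> tens R n :=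
  match n return tens R n -> tens R n with
  | 0 => id
  | m.+1 => fun v =>
    match m return tens R m.+1 -> tens R m.+1 -> tens R m.+1 with
    | 0 => fun _ w => w
    | k.+1 => fun v w => if j == k then ((v.1.1, v.2.1), (v.1.2, v.2.2)) else w
    end v (swp_rec j v.1, swp_rec j v.2)
  end.

Fixpoint std_poly_rec (R : comNzRingType) (n c : nat) : tens R n :=
  match n return tens R n with
  | 0 => (1 : R)
  | m.+1 =>
    if (c.*2 <= m)%N then (std_poly_rec R m c, 0)
    else match m return tens R m.+1 with
         | 0 => 0
         | k.+1 => ((0, - std_poly_rec R k c.-1), (std_poly_rec R k c.-1, 0))
         end
  end.

Fixpoint ev_rec (R : comNzRingType) (n : nat) : tens R n -> (nat -> bool) -> R :=
  match n return tens R n -> (nat -> bool) -> R with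
  | 0 => fun v _ => v
  | m.+1 => fun v f => if f m then ev_rec v.2 f else ev_rec v.1 f
  end.

(* [swp j] exchanges the entries [j] and [j.+1]; [std_poly n c] is the polytabloid
   of the tableau with columns [{2k, 2k+1}] for [k < c], the remaining entries
   lying in row 1; [ev v f] is the coefficient in [v] of the tabloid whose row 2
   is [{i < n | f i}]. *)
HB.lock Definition swp (R : comNzRingType) (n j : nat) (v : tens R n) := swp_rec j v.
HB.lock Definition std_poly (R : comNzRingType) (n c : nat) : tens R n := std_poly_rec R n c.
HB.lock Definition ev (R : comNzRingType) (n : nat) (v : tens R n) (f : nat -> bool) : R :=
  ev_rec v f.
Arguments swp {R n}.
Arguments std_poly {R}.
Arguments ev {R n}.

Definition adjswap (j i : nat) : nat :=
  if i == j then j.+1 else if i == j.+1 then j else i.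

Lemma adjswap_id j i : i != j -> i != j.+1 -> adjswap j i = i.
Proof. by rewrite /adjswap => /negPf-> /negPf->. Qed.

Section Polytabloids.

Variable R : comNzRingType.
Local Notation tens := (tens R).
Lemma swp_nil j (v : tens 0) : swp j v = v.
Proof. by rewrite swp.unlock. Qed.

Lemma swp_top n (a b a' b' : tens n) :
  swp n (((a, b), (a', b')) : tens n.+2) = ((a, a'), (b, b')).
Proof. by rewrite swp.unlock /= eqxx. Qed.

Lemma swp_pair n j (x y : tens n) : j.+1 != n ->
  swp j ((x, y) : tens n.+1) = (swp j x, swp j y).
Proof. by rewrite swp.unlock; case: n x y => //= n x y; rewrite eqSS => /negPf->. Qed.

(** Either the last two factors are exchanged, or the last factor is untouched. The second case
    includes [j] out of range, where the swap is the identity. *)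
Lemma swp_ind (P : forall n, nat -> tens n -> Prop) :
  (forall j v, P 0%N j v) ->
  (forall n a b a' b', P n.+2 n ((a, b), (a', b'))) ->
  (forall n j x y, j.+1 != n -> (forall v, P n j v) -> P n.+1 j (x, y)) ->
  forall n j v, P n j v.
Proof.
move=> P0 Ptop Ppair; elim=> [|n IH] j v; first exact: P0.
have [jn|jn] := eqVneq j.+1 n.
  by case: n / jn {IH} v => -[[a b] [a' b']]; apply: Ptop.
by elim/tens_ind: v => x y; apply: Ppair.
Qed.

Lemma swpD n j (v w : tens n) : swp j (v + w) = swp j v + swp j w.
Proof.
move: n j v w; apply: swp_ind => [j v|n a b a' b'|n j x y jn IH]; first by move=> w; rewrite !swp_nil.
  by case=> -[? ?] [? ?]; rewrite !pairE !swp_top.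
by elim/tens_ind=> ? ?; rewrite !pairE !swp_pair // !IH.
Qed.

Lemma swp0 n j : swp j (0 : tens n) = 0.
Proof. by apply: (addrI (swp j 0)); rewrite -swpD !addr0. Qed.

Lemma lower_swp n i j (v : tens n) : lower i (swp j v) = swp j (lower i v).
Proof.
move: n j v i; apply: swp_ind => [j v|n a b a' b'|n j x y jn IH] i; first by rewrite !swp_nil.
  rewrite swp_top; case: i => [|[|i]]; rewrite ?lower0 ?swp_top // !pairE swp_top.
    by rewrite !lower0 !addr0; congr ((_, _), (_, _)); rewrite addrAC.
  by rewrite !addrA; congr ((_, _), (_, _)); rewrite [LHS](ACl (1*3*2*4))%AC.
rewrite swp_pair // !pairE swp_pair // swpD !IH; congr (_ + _, _).
by case: i => [|i]; rewrite ?swp0.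
Qed.

Lemma gr_swp n (c : int) j (v : tens n) : gr c (swp j v) = swp j (gr c v).
Proof.
move: n j v c; apply: swp_ind => [j v|n a b a' b'|n j x y jn IH] c; first by rewrite !swp_nil.
  by rewrite swp_top !pairE swp_top.
by rewrite swp_pair // !pairE swp_pair // !IH.
Qed.

Lemma raise_swp n j (v : tens n) : raise (swp j v) = swp j (raise v).
Proof.
move: n j v; apply: swp_ind => [j v|n a b a' b'|n j x y jn IH]; first by rewrite !swp_nil.
  by rewrite swp_top !pairE swp_top; congr (_, (_, _)); rewrite addrAC.
by rewrite swp_pair // !pairE swp_pair // swpD !IH.
Qed.

Lemma hw_swp n (c : int) j (v : tens n) : hw c v -> hw c (swp j v).
Proof.
move=> [vc v0]; split=> [|i]; first by rewrite /homog gr_swp vc.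
by rewrite lower_swp v0 swp0.
Qed.

Lemma std_poly_tail n (c : nat) : (c.*2 <= n)%N -> std_poly n.+1 c = (std_poly n c, 0) :> tens n.+1.
Proof. by rewrite std_poly.unlock /= => ->. Qed.

Lemma std_poly_double (c : nat) :
  std_poly c.*2.+2 c.+1 = ((0, - std_poly c.*2 c), (std_poly c.*2 c, 0)) :> tens c.*2.+2.
Proof.
have cE : (c.+1.*2 <= c.*2.+1)%N = false by lia.
by rewrite std_poly.unlock /= cE.
Qed.

(** The last entry either lies in the tail of row 1 or, when [n = 2c], closes the last column. *)
Lemma std_poly_ind (P : forall n c : nat, tens n -> Prop) :
  P 0%N 0%N (std_poly 0 0) ->
  (forall n c, (c.*2 <= n)%N -> P n c (std_poly n c) -> P n.+1 c (std_poly n c, 0)) ->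
  (forall c, P c.*2 c (std_poly c.*2 c) ->
     P c.*2.+2 c.+1 ((0, - std_poly c.*2 c), (std_poly c.*2 c, 0))) ->
  forall n c, (c.*2 <= n)%N -> P n c (std_poly n c).
Proof.
move=> P0 Ptail Pdbl; elim/ltn_ind=> -[|n] IH c cn.
  by case: c cn.
have [cn'|nc] := leqP c.*2 n; first by rewrite std_poly_tail //; apply: Ptail => //; apply: IH.
have cE : c.*2 = n.+1 by lia.
case: c cE {cn nc} => // c [cE]; case: n / cE IH => IH.
by rewrite std_poly_double; apply: Pdbl; apply: IH.
Qed.

(** Each column contributes an antisymmetric tensor and each tail entry a row 1 vector; [E] kills
    both. *)
Lemma hw_std_poly n (c : nat) : (c.*2 <= n)%N -> hw c%:Z (std_poly n c : tens n).
Proof.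
move: n c; apply: (std_poly_ind (P := fun n c v => hw c%:Z v)) => [|n c cn IH|c IH].
- by split=> [|i]; rewrite ?/homog ?gr_nil ?lower_nil.
- exact/hw_pair0P.
have [qc q0] := IH; have qc' : homog (c.+1%:Z - 1) (std_poly c.*2 c : tens c.*2).
  by move: qc; congr (homog _ _); lia.
apply/hw_pairP; split=> [|||i].
- by apply/homog_pairP; split; [apply: homog0 | rewrite -scaleN1r; apply: homogZ].
- by apply/hw_pair0P; split.
- by rewrite !pairE linear0 add0r lower0 linearN /= q0 oppr0.
- by rewrite !pairE !linear0 !linearN /= !q0 oppr0 addr0.
Qed.

Inductive poly_orbit n (c : nat) : tens n -> Prop :=
| poly_orbit_std : poly_orbit c (std_poly n c)
| poly_orbit_swp j u : (j.+1 < n)%N -> poly_orbit c u -> poly_orbit c (swp j u).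

Inductive poly_span n (c : nat) : tens n -> Prop :=
| poly_span0 : poly_span c 0
| poly_spanD a u v : poly_orbit c u -> poly_span c v -> poly_span c (a *: u + v).

Lemma poly_span_add n (c : nat) (v w : tens n) : poly_span c v -> poly_span c w -> poly_span c (v + w).
Proof.
move=> vS wS; elim: vS => [|a u v' uG _ IH]; first by rewrite add0r.
by rewrite -addrA; apply: poly_spanD.
Qed.

Lemma hw_poly_orbit n (c : nat) (v : tens n) : (c.*2 <= n)%N -> poly_orbit c v -> hw c%:Z v.
Proof. by move=> cn; elim=> [|j u _ _]; [apply: hw_std_poly | apply: hw_swp]. Qed.

Lemma hw_poly_span n (c : nat) (v : tens n) : (c.*2 <= n)%N -> poly_span c v -> hw c%:Z v.
Proof.
move=> cn; elim=> [|a u w uG _ wS]; first exact: hw0.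
by apply: hwD => //; apply: hwZ; apply: hw_poly_orbit.
Qed.

Lemma poly_orbit_pair0 n (c : nat) (u : tens n) : (c.*2 <= n)%N ->
  poly_orbit c u -> poly_orbit c ((u, 0) : tens n.+1).
Proof.
move=> cn; elim=> [|j w jn _ wG]; first by rewrite -std_poly_tail //; apply: poly_orbit_std.
rewrite -(swp0 n j) -swp_pair; first by apply: poly_orbit_swp => //; lia.
by lia.
Qed.

(** The bound leaves an entry of row 1 with nothing below it, under which the new entry is
    placed. *)
Lemma poly_orbit_pair n (c : nat) (u : tens n) : (c.+1.*2 <= n.+1)%N -> poly_orbit c u ->
  exists x, poly_orbit c.+1 ((x, u) : tens n.+1).
Proof.
move=> cn; elim=> {u} [|j w jn _ [x xG]]; last first.
  exists (swp j x); rewrite -swp_pair; last by lia.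
  by apply: poly_orbit_swp => //; lia.
elim: n cn => // n IH; rewrite leq_eqVlt => /orP[/eqP cE|cn].
  have nE : n = c.*2 by lia.
  subst n; exists (0, - std_poly c.*2 c).
  by rewrite std_poly_tail // -std_poly_double; apply: poly_orbit_std.
have [x xG] : exists x, poly_orbit c.+1 ((x, std_poly n c) : tens n.+1) by apply: IH; lia.
(* Append a row 1 factor to the smaller solution [(x, std_poly n c)], then exchange the last two
   factors. *)
exists (x, 0); rewrite std_poly_tail; last by lia.
rewrite -swp_top; apply: poly_orbit_swp => //; apply: poly_orbit_pair0 => //; lia.
Qed.

Lemma poly_span_pair n (c : nat) (y : tens n) : (c.+1.*2 <= n.+1)%N -> poly_span c y ->
  exists x, poly_span c.+1 ((x, y) : tens n.+1).
Proof.
move=> cn; elim=> [|a u v uG _ [x xS]]; first by exists 0; apply: poly_span0.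
have [x' xG] := poly_orbit_pair cn uG.
by exists (a *: x' + x); rewrite -pair_add -pair_scale; apply: poly_spanD.
Qed.

Lemma poly_span_pair0 n (c : nat) (x : tens n) : (c.*2 <= n)%N -> poly_span c x ->
  poly_span c ((x, 0) : tens n.+1).
Proof.
move=> cn; elim=> [|a u v uG _ vS]; first exact: poly_span0.
rewrite -[X in (_, X)](addr0 0) -{1}(scaler0 _ a) -pair_add -pair_scale.
by apply: poly_spanD => //; apply: poly_orbit_pair0.
Qed.

(** By induction the second component is a combination of polytabloids, which lifts by
    [poly_span_pair]. Subtracting the lift leaves a vector of degree [c] on one factor less, covered
    by induction or zero by [hw_vanish]. The argument holds over any ring, hence both over the
    integers and mod p. *)
Lemma poly_span_hw n (c : nat) (v : tens n) : (c.*2 <= n)%N -> hw c%:Z v -> poly_span c v.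
Proof.
elim: n c v => [|n IH] c v cn vS.
  have c0 : c = 0%N by lia.
  rewrite c0 -[v]addr0; have -> : v = (v : R) *: (std_poly 0 0 : tens 0).
    by rewrite std_poly.unlock /=; apply/esym/mulr1.
  by apply: poly_spanD; [apply: poly_orbit_std | apply: poly_span0].
have red (x : tens n) : hw c%:Z x -> poly_span c ((x, 0) : tens n.+1).
  move=> xS; have [cn'|nc] := leqP c.*2 n.
    by apply: poly_span_pair0 => //; apply: IH.
  by rewrite (hw_vanish _ xS); [apply: poly_span0 | lia].
move: vS; elim/tens_ind: v => x y /[dup] vS /hw_pairP[xc yS _ _].
case: c cn vS xc yS red => [|c] cn vS xc yS red.
  have y0 : y = 0 by apply: (homog_lt0 _ (proj1 yS)).
  by rewrite y0 in vS *; apply: red; apply/hw_pair0P.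
have [x' x'S] : exists x', poly_span c.+1 ((x', y) : tens n.+1).
  apply: poly_span_pair => //; apply: IH; first by lia.
  by move: yS; congr (hw _ _); lia.
have -> : (x, y) = (x - x', 0) + (x', y) :> tens n.+1 by rewrite pair_add subrK add0r.
apply: poly_span_add => //; apply: red; apply/hw_pair0P.
have -> : (x - x', 0) = (x, y) - (x', y) :> tens n.+1 by rewrite pair_opp pair_add subrr.
by apply: hwD => //; apply: hwN; apply: hw_poly_span.
Qed.

Lemma ev_nil (v : tens 0) f : ev v f = v.
Proof. by rewrite ev.unlock. Qed.

Lemma ev_pair n (x y : tens n) f :
  ev ((x, y) : tens n.+1) f = if f n then ev y f else ev x f.
Proof. by rewrite ev.unlock. Qed.

Lemma ev_linear n f : scalar (fun v : tens n => ev v f).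
Proof.
elim: n => [|n IH] k; first by move=> u v; rewrite !ev_nil.
elim/tens_ind=> x y; elim/tens_ind=> x' y'; rewrite !pairE !ev_pair.
by case: ifP => _; apply: IH.
Qed.

Lemma evD n (v w : tens n) f : ev (v + w) f = ev v f + ev w f.
Proof. by rewrite -[v]scale1r ev_linear mul1r scale1r. Qed.

Lemma ev0 n f : ev (0 : tens n) f = 0.
Proof. by apply: (addrI (ev (0 : tens n) f)); rewrite -evD !addr0. Qed.

Lemma evZ n k (v : tens n) f : ev (k *: v) f = k * ev v f.
Proof. by rewrite -[k *: v]addr0 ev_linear ev0 addr0. Qed.

Lemma evN n (v : tens n) f : ev (- v) f = - ev v f.
Proof. by rewrite -scaleN1r evZ mulN1r. Qed.

Lemma ev_ext n (v : tens n) f g : (forall i, (i < n)%N -> f i = g i) -> ev v f = ev v g.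
Proof.
elim: n v => [|n IH] v; first by rewrite !ev_nil.
elim/tens_ind: v => x y fg; rewrite !ev_pair fg //.
by case: ifP => _; apply: IH => i ni; apply: fg; lia.
Qed.

Lemma ev_inj n (v w : tens n) : (forall f, ev v f = ev w f) -> v = w.
Proof.
elim: n v w => [|n IH]; first by move=> v w /(_ xpred0); rewrite !ev_nil.
elim/tens_ind=> x y; elim/tens_ind=> x' y' E.
have upd b f : exists2 g : nat -> bool, g n = b & forall i, (i < n)%N -> g i = f i.
  by exists (fun i => if i == n then b else f i) => [|i]; rewrite ?eqxx //; case: eqP; lia.
congr (_, _); apply: IH => f.
  have [g gn gf] := upd false f; have := E g; rewrite !ev_pair gn.
  by rewrite !(ev_ext _ gf).
have [g gn gf] := upd true f; have := E g; rewrite !ev_pair gn.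
by rewrite !(ev_ext _ gf).
Qed.

Lemma ev_swp n j (v : tens n) f : (j.+1 < n)%N -> ev (swp j v) f = ev v (f \o adjswap j).
Proof.
move: n j v f; apply: swp_ind => // [n a b a' b'|n j x y jn IH] f jn1.
  have E i : (i < n)%N -> f i = (f \o adjswap n) i by move=> iS; rewrite /= adjswap_id //; lia.
  rewrite swp_top !ev_pair /= /adjswap !eqxx (gtn_eqF (ltnSn n)).
  by do 2!case: ifP => _; apply: ev_ext.
rewrite swp_pair // !ev_pair !IH; try lia.
by rewrite /= adjswap_id //; lia.
Qed.

(** A column contributes 1 if its odd entry alone is in row 2, -1 if its even entry alone is, and 0
    otherwise; the second product requires the tail to lie in row 1. *)
Definition std_poly_val n c (f : nat -> bool) : R :=
  (\prod_(k < c) ((f k.*2.+1)%:R - (f k.*2)%:R)) * \prod_(c.*2 <= i < n) (~~ f i)%:R.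

Lemma ev_std_poly n c f : (c.*2 <= n)%N -> ev (std_poly n c : tens n) f = std_poly_val n c f.
Proof.
move=> cn; move: n c cn f.
apply: (std_poly_ind (P := fun n c v => forall f, ev v f = std_poly_val n c f)) => // [f|n c cn IH f|c IH f].
- by rewrite /std_poly_val ev_nil big_ord0 big_geq // std_poly.unlock mulr1.
- rewrite /std_poly_val ev_pair ev0 big_nat_recr //= mulrA -[_ * \prod_(_ <= i < n) _]/(std_poly_val n c f) -IH.
  by case: (f n); rewrite ?mulr0 ?mulr1.
have := IH f; rewrite /std_poly_val !ev_pair evN ev0 (big_geq (leqnn _)) => ->.
rewrite big_ord_recr /= (big_geq (leqnn _)) !mulr1.
by case: (f c.*2); case: (f c.*2.+1); rewrite ?subrr ?mulr0 ?subr0 ?sub0r ?mulr1 ?mulrN1.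
Qed.

End Polytabloids.

(** * Tabloids and tableaux *)

(** Transpositions generate, and [tperm i j] is the conjugate of [tperm i m], with [m = j - 1], by
    the adjacent [tperm m j]. *)
Lemma adjacent_ind n (P : 'S_n -> Prop) :
  P 1%g -> (forall s u, P s -> P u -> P (s * u)%g) ->
  (forall i j : 'I_n, j = i.+1 :> nat -> P (tperm i j)) ->
  forall s, P s.
Proof.
move=> P1 PM Padj.
have Ptp k (i j : 'I_n) : j = (i + k.+1)%N :> nat -> P (tperm i j).
  elim: k i j => [|k IH] i j ij; first by apply: Padj; lia.
  have mn : (i + k.+1 < n)%N by have := ltn_ord j; lia.
  pose m := Ordinal mn; have Pmj : P (tperm m j) by apply: Padj; rewrite /=; lia.
  have -> : tperm i j = (tperm i m ^ tperm m j)%g.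
    rewrite tpermJ tpermL tpermD //; apply/eqP=> /(congr1 val) /=; lia.
  by rewrite conjgE tpermV; apply: (PM) => //; apply: (PM) => //; apply: IH.
move=> s; have [ts -> _] := prod_tpermP s.
elim: ts => [|[i j] ts IH]; rewrite ?big_nil // big_cons; apply: PM => //=.
have [ij|ji|/val_inj->] := ltngtP i j; last by rewrite tperm1.
  by apply: (Ptp (j - i).-1); lia.
by rewrite tpermC; apply: (Ptp (i - j).-1); lia.
Qed.

(** The inverse of [ev]. Only functions that are false from [n] on are fed to [phi], whence the
    truncation in [ev_build]. *)
Fixpoint build (R : comNzRingType) (n : nat) (phi : (nat -> bool) -> R) : tens R n :=
  match n return tens R n with
  | 0 => phi (fun=> false)
  | m.+1 => (build m phi, build m (fun f => phi (fun i => (i == m) || f i)))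
  end.

Lemma ev_build (R : comNzRingType) n (phi : (nat -> bool) -> R) f :
  ev (build n phi) f = phi (fun i => (i < n)%N && f i).
Proof.
elim: n phi => [|n IH] phi; first by rewrite ev_nil.
rewrite ev_pair !IH; case: ifP => fn; congr (phi _); apply/funext=> i.
  by rewrite [in RHS]ltnS [in RHS]leq_eqVlt; case: eqP => [->|_] //; rewrite fn.
by rewrite [in RHS]ltnS [in RHS]leq_eqVlt; case: eqP => [->|_] //; rewrite fn ltnn.
Qed.

Definition rows_of n (f : nat -> bool) : {ffun 'I_n -> 'I_2} :=
  [ffun i : 'I_n => if f i then ord_max else ord0].

Definition bits_of n (g : {ffun 'I_n -> 'I_2}) (i : nat) : bool :=
  if insub i is Some j then g j != ord0 else false.

Lemma bits_ofE n (g : {ffun 'I_n -> 'I_2}) (i : 'I_n) : bits_of g i = (g i != ord0).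
Proof. by rewrite /bits_of valK. Qed.

Lemma I2_max (r : 'I_2) : (r != ord0) = (r == ord_max).
Proof. by case: r => [[|[|]]]. Qed.

Lemma bits_ofK n : cancel (@bits_of n) (@rows_of n).
Proof.
move=> g; apply/ffunP=> i; rewrite ffunE bits_ofE I2_max.
by case: eqP => // /eqP; rewrite -I2_max negbK => /eqP.
Qed.

Lemma rows_of_relabel n (f : nat -> bool) (i j : 'I_n) : j = i.+1 :> nat ->
  relabel (tperm i j) (rows_of n f) = rows_of n (f \o adjswap i).
Proof.
move=> ij; apply/ffunP=> k; rewrite !ffunE tpermV /= /adjswap.
case: tpermP => [->|->|ki kj].
- by rewrite eqxx ij.
- by rewrite ij eqxx eqn_leq ltnn.
- have -> : (k == i :> nat) = false by apply/eqP => /val_inj.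
  by rewrite -ij; have -> : (k == j :> nat) = false by apply/eqP => /val_inj.
Qed.

(** * Permutation modules inside the tensor power *)

Section Embedding.

Variables (n : nat) (d : diagram).
Local Notation permZ := (permZ n d).

(** Extension by zero to all row assignments, so that every shape with [n] boxes embeds in the same
    tensor power. *)
Definition ext (x : permZ) (g : {ffun 'I_n -> 'I_2}) : int :=
  if insub g is Some T then x (T : tabloid n d) else 0.

Lemma ext_val x (T : tabloid n d) : ext x (val T) = x T.
Proof. by rewrite /ext valK. Qed.

Lemma ext_out x g : ~~ is_tabloid d g -> ext x g = 0.
Proof. by move=> gT; rewrite /ext insubN. Qed.

Lemma extB x y g : ext (x - y) g = ext x g - ext y g.
Proof. by rewrite /ext; case: insubP => [T _ _|_]; rewrite ?subr0 // !ffunE. Qed.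

Lemma ext_act s x g : ext (permZ_act s x) g = ext x (relabel s^-1 g).
Proof.
have [gT|gT] := boolP (is_tabloid d g).
  pose T : tabloid n d := exist _ g gT.
  by rewrite -[g]/(val T) ext_val ffunE -ext_val.
rewrite !ext_out //; apply: contraNN gT => /(is_tabloid_relabel s).
by rewrite relabelKV.
Qed.

Variable R : comNzRingType.

Definition emb (x : permZ) : tens R n := build n (fun f => (ext x (rows_of n f))%:~R).

Lemma ev_emb x f : ev (emb x) f = (ext x (rows_of n f))%:~R.
Proof.
rewrite ev_build; congr ((ext x _)%:~R).
by apply/ffunP=> i; rewrite !ffunE ltn_ord.
Qed.

Lemma emb_zmod : zmod_morphism emb.
Proof.
move=> x y; apply: ev_inj => f.
by rewrite evD evN !ev_emb extB intrB.
Qed.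
HB.instance Definition _ :=
  GRing.isZmodMorphism.Build permZ (tens R n) emb emb_zmod.

Lemma emb_act_adj (i j : 'I_n) x : j = i.+1 :> nat ->
  emb (permZ_act (tperm i j) x) = swp i (emb x).
Proof.
move=> ij; apply: ev_inj => f; rewrite ev_swp; last by rewrite -ij.
by rewrite !ev_emb ext_act tpermV rows_of_relabel.
Qed.

Lemma permZ_act1 (x : permZ) : permZ_act 1 x = x.
Proof. by apply/ffunP=> T; rewrite ffunE invg1 tabloid_act1. Qed.

Lemma permZ_actM s u (x : permZ) : permZ_act s (permZ_act u x) = permZ_act (u * s)%g x.
Proof. by apply/ffunP=> T; rewrite !ffunE tabloid_actM invMg. Qed.

Lemma hw_emb_act c s x : hw c (emb x) -> hw c (emb (permZ_act s x)).
Proof.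
elim/adjacent_ind: s x => [x|s u sP uP x /sP /uP|i j ij x xS]; first by rewrite permZ_act1.
  by rewrite permZ_actM.
by rewrite emb_act_adj //; apply: hw_swp.
Qed.

End Embedding.

(** By [adjacent_ind], commuting with adjacent swaps is enough. The two shapes may differ, since [F]
    changes the shape. *)
Lemma emb_equivariant n d d' (R : comNzRingType) (phi : tens R n -> tens R n) s
    (x : permZ n d) (y : permZ n d') :
  (forall j v, phi (swp j v) = swp j (phi v)) ->
  phi (emb R x) = emb R y -> phi (emb R (permZ_act s x)) = emb R (permZ_act s y).
Proof.
move=> phiS; elim/adjacent_ind: s x y => [x y|s u sP uP x y /sP /uP|i j ij x y xy].
- by rewrite !permZ_act1.
- by rewrite !permZ_actM.
- by rewrite !emb_act_adj // phiS xy.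
Qed.


(** * The tableau with columns [{2k, 2k+1}] *)

Section StandardTableau.

Variables (a c : nat).
Hypothesis ca : (c <= a)%N.
Local Notation n := (a + c)%N.
Local Notation d := (Some (a, c)).

(** The first [2c] entries fill [c] columns, so a later entry [i] sits in column [c + (i - 2c)]. *)
Definition std_col (i : nat) : nat := if (i < c.*2)%N then i./2 else (i - c)%N.

Lemma std_col_le i : (std_col i <= i)%N.
Proof. by rewrite /std_col; case: ifP; lia. Qed.

Definition std_tab : {ffun 'I_n -> box n} :=
  [ffun i : 'I_n => (if (i < c.*2)%N && odd i then ord_max else ord0,
                     Ordinal (leq_ltn_trans (std_col_le i) (ltn_ord i)))].

Lemma std_tab_inj : injective std_tab.
Proof.
move=> i j; rewrite !ffunE => -[rE cE]; apply: val_inj => /=; move: rE cE.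
by rewrite /std_col; case: (ltnP i) => ic; case: (ltnP j) => jc /=;
  case: (boolP (odd i)) => io; case: (boolP (odd j)) => jo // _; lia.
Qed.

Lemma std_tab_is_tableau : is_tableau d std_tab.
Proof.
rewrite /is_tableau; apply/andP; split; first exact/injectiveP/std_tab_inj.
apply/forallP=> -[r k]; apply/eqP; apply/codomP/idP => /= [[i]|].
  rewrite ffunE /row_length => -[-> ->] /=; have := ltn_ord i; rewrite /std_col.
  by case: (ltnP i c.*2) => ic /=; [case: (boolP (odd i)) => io /= |]; lia.
have kn := ltn_ord k.
have box_at (i : nat) (lt_in : (i < n)%N) : std_col i = k ->
    (if (i < c.*2)%N && odd i then ord_max else ord0) = r ->
    exists i, (r, k) = std_tab i.
  move=> iE rE; exists (Ordinal lt_in); rewrite ffunE /= rE; congr (_, _).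
  exact: val_inj.
rewrite /row_length; case: eqP => [r0 /= ka|/eqP]; last rewrite I2_max => /eqP r1 /= kc.
  have [kc|ck] := ltnP k c.
    have lt_in : (k.*2 < n)%N by lia.
    apply: (box_at _ lt_in); rewrite /std_col.
      by rewrite ltn_double kc doubleK.
    by rewrite odd_double andbF r0.
  have lt_in : (k + c < n)%N by lia.
  have kc2 : (k + c < c.*2)%N = false by lia.
  by apply: (box_at _ lt_in); rewrite /std_col kc2 ?addnK // r0.
have lt_in : (k.*2.+1 < n)%N by lia.
have kc2 : (k.*2.+1 < c.*2)%N by lia.
apply: (box_at _ lt_in); rewrite /std_col kc2; first by lia.
by rewrite /= odd_double r1.
Qed.

(** Both tableaux are injective with the same image, so sending [i] to the entry of [std_tab] in the
    box [t i] is a permutation. *)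
Lemma tableau_relabel t : is_tableau d t -> exists s, t = relabel s std_tab.
Proof.
rewrite /is_tableau => /andP[/injectiveP t_inj /forallP tP].
have := std_tab_is_tableau; rewrite /is_tableau => /andP[_ /forallP sP].
have tS i : t i \in codom std_tab.
  by rewrite (eqP (sP _)) -(eqP (tP _)) codom_f.
have u_inj : injective (fun i => iinv (tS i)).
  by move=> i j /(congr1 std_tab); rewrite !f_iinv => /t_inj.
exists (perm u_inj)^-1%g; apply/ffunP=> i; rewrite ffunE invgK permE.
by rewrite f_iinv.
Qed.

End StandardTableau.

Lemma polytabloid_antisym n d (t : {ffun 'I_n -> box n}) u (T : tabloid n d) :
  u \in column_stabilizer t ->
  polytabloid d t (tabloid_act u T) = (-1) ^+ u * polytabloid d t T.
Proof.
rewrite inE => /forallP uC; rewrite !ffunE (reindex_inj (mulIg u)) mulr_sumr /=.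
apply: eq_big => [s|s _].
  rewrite !inE; apply/forallP/forallP => sC i; have := sC i; rewrite permM.
    by rewrite (eqP (uC _)).
  by rewrite (eqP (uC _)).
rewrite odd_permM signr_addb mulrC -mulrnAr; congr (_ * (_ *+ nat_of_bool _)).
rewrite -relabelM [in LHS]tableau_rows_relabel.
by rewrite (inj_eq (can_inj (@relabelK _ _ _))).
Qed.

Lemma std_poly_val_swap (R : comNzRingType) n c m f : (m < c)%N ->
  std_poly_val R n c (f \o adjswap m.*2) = - std_poly_val R n c f.
Proof.
move=> mc; rewrite /std_poly_val -mulNr; congr (_ * _).
  rewrite (bigD1 (Ordinal mc)) // [in RHS](bigD1 (Ordinal mc)) //= -mulNr.
  congr (_ * _).
    rewrite /adjswap eqxx; have -> : (m.*2.+1 == m.*2) = false by lia.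
    by rewrite eqxx opprB.
  apply: eq_bigr => k /eqP/eqP; rewrite -val_eqE /= => km.
  by rewrite !adjswap_id //; lia.
rewrite !big_nat; apply: eq_bigr => i ci.
by rewrite /= adjswap_id //; lia.
Qed.

(** * Coefficients of the standard polytabloid *)

Section StandardPolytabloid.

Variables (a c : nat).
Hypothesis ca : (c <= a)%N.
Local Notation n := (a + c)%N.
Local Notation d := (Some (a, c)).
Local Notation t0 := (std_tab ca).

Lemma pair_swap_column m (i j : 'I_n) : (m < c)%N -> i = m.*2 :> nat -> j = m.*2.+1 :> nat ->
  tperm i j \in column_stabilizer t0.
Proof.
move=> mc im jm; have ij : (t0 i).2 = (t0 j).2.
  rewrite !ffunE; apply: val_inj; rewrite /= /std_col im jm.
  have -> : (m.*2 < c.*2)%N by lia.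
  have -> : (m.*2.+1 < c.*2)%N by lia.
  lia.
rewrite inE; apply/forallP=> k; case: tpermP => [->|->|_ _] //; exact/eqP.
Qed.

(** Both sides change sign when a column is flipped, so all even entries below [2c] may be assumed
    to lie in row 1. Then only the tabloid of the tableau itself has a nonzero coefficient. *)
Lemma polytabloid_std (T : tabloid n d) f : val T = rows_of n f ->
  polytabloid d t0 T = std_poly_val int n c f.
Proof.
(* Here [m] bounds the columns still to be normalised; [m = c] imposes nothing. *)
suff H m : (m <= c)%N -> forall f (T : tabloid n d), val T = rows_of n f ->
    (forall k, (m <= k < c)%N -> f k.*2 = false) -> polytabloid d t0 T = std_poly_val int n c f.
  by move=> TE; apply: (H c) => // k; lia.
elim: m => [|m IH] mc {T}{}f T TE fE; last first.
  have [fm|fm] := boolP (f m.*2); last first.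
    apply: IH => // [|k]; first by lia.
    by rewrite leq_eqVlt => /andP[/orP[/eqP<- _|mk kc]]; [apply/negbTE | apply: fE; lia].
  have [im jm] : (m.*2 < n)%N /\ (m.*2.+1 < n)%N by lia.
  pose u := tperm (Ordinal im) (Ordinal jm).
  have uC : u \in column_stabilizer t0 by apply: (pair_swap_column mc).
  have uT : val (tabloid_act u T) = rows_of n (f \o adjswap m.*2).
    by rewrite -(rows_of_relabel _ (i := Ordinal im) (j := Ordinal jm)) //= TE.
  have uE : polytabloid d t0 (tabloid_act u T) = - polytabloid d t0 T.
    by rewrite polytabloid_antisym // odd_tperm -val_eqE /= ltn_eqF // expr1 mulN1r.
  (* If both entries are in row 2, the flip fixes [T] and the coefficient equals its own negative;
     otherwise the flip normalises column [m]. *)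
  have [fm'|fm'] := boolP (f m.*2.+1).
    have uTT : tabloid_act u T = T.
      apply: val_inj; rewrite uT TE; congr (rows_of _ _); apply/funext => i /=.
      by rewrite /adjswap; case: eqP => [->|_]; [rewrite fm fm' | case: eqP => // ->; rewrite fm fm'].
    have q0 : std_poly_val int n c f = 0.
      by rewrite /std_poly_val (bigD1 (Ordinal mc)) //= fm fm' subrr !mul0r.
    by rewrite q0; move: uE; rewrite uTT; lia.
  apply: oppr_inj; rewrite -uE -(std_poly_val_swap _ _ _ mc); apply: IH => // [|k mk].
    exact: ltnW.
  have [->|km] := eqVneq k m; first by rewrite /= /adjswap eqxx (negbTE fm').
  by rewrite /= adjswap_id ?fE //; lia.
(* A tail entry is alone in its column, so no column permutation moves it to row 2. *)
have tail0 (i : 'I_n) : (c.*2 <= i)%N -> f i -> polytabloid d t0 T = 0.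
  move=> ci fi; rewrite ffunE big1 // => s; rewrite inE => /forallP sC.
  case: eqP => // /(congr1 (fun g : {ffun _ -> _} => g i)).
  rewrite TE !ffunE fi => /(congr1 val) /=.
  have := eqP (sC (s^-1%g i)); rewrite permKV !ffunE /= => /(congr1 val) /=.
  case: ifP => // /andP[si _]; rewrite /std_col si ltnNge ci /=; lia.
have [/existsP[i /andP[ci fi]]|/existsPn notail] :=
  boolP [exists i : 'I_n, (c.*2 <= i)%N && f i].
  rewrite (tail0 i) // /std_poly_val (bigD1_seq (i : nat)) ?iota_uniq //=.
    by rewrite fi mul0r mulr0.
  by rewrite mem_index_iota ci ltn_ord.
have [/existsP[k fk]|/existsPn fodd] := boolP [exists k : 'I_c, ~~ f k.*2.+1].
  have q0 : std_poly_val int n c f = 0.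
    by rewrite /std_poly_val (bigD1 k) //= (fE k) ?ltn_ord // (negbTE fk) subrr !mul0r.
  have kc := ltn_ord k.
  have [im jm] : (k.*2 < n)%N /\ (k.*2.+1 < n)%N by lia.
  pose u := tperm (Ordinal im) (Ordinal jm).
  have uC : u \in column_stabilizer t0 by apply: (pair_swap_column kc).
  have uTT : tabloid_act u T = T.
    apply: val_inj; rewrite /= TE (rows_of_relabel _ (i := Ordinal im) (j := Ordinal jm)) //.
    congr (rows_of _ _); apply/funext => i /=; rewrite /adjswap.
    by case: eqP => [->|_]; [|case: eqP => // ->]; rewrite fE ?(negbTE fk) // ltn_ord.
  have := polytabloid_antisym T uC.
  by rewrite uTT odd_tperm -val_eqE /= ltn_eqF // expr1 mulN1r q0; lia.
have {}fodd k : (k < c)%N -> f k.*2.+1.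
  by move=> kc; have := fodd (Ordinal kc); rewrite negbK.
have TE0 : val T = tableau_rows t0.
  rewrite TE; apply/ffunP=> i; rewrite !ffunE /=; have [ic|ci] := ltnP i c.*2.
    have := odd_double_half i; case: (odd i) => <- /=; last by rewrite add0n fE //; lia.
    by rewrite add1n fodd //; lia.
  by have := notail i; rewrite ci /= => /negbTE->.
have -> : std_poly_val int n c f = 1.
  rewrite /std_poly_val big1 ?mul1r => [|k _]; last by rewrite fodd ?fE ?ltn_ord // subr0.
  rewrite big_nat big1 // => i /andP[ci lt_in].
  by have := notail (Ordinal lt_in); rewrite /= ci /= => ->.
(* Only the identity contributes: a permutation preserving both rows and columns fixes every box. *)
rewrite ffunE (bigD1 1%g) /=; last by rewrite inE; apply/forallP=> i; rewrite perm1.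
rewrite odd_perm1 relabel1 TE0 eqxx big1 ?addr0 // => s /andP[].
rewrite inE => /forallP sC; apply: contraNeq.
case: (tableau_rows t0 =P _) => [E _|_]; last by rewrite eqxx.
apply/eqP/permP => i; rewrite perm1.
apply: (@std_tab_inj a c ca); rewrite [LHS]surjective_pairing [RHS]surjective_pairing.
congr (_, _); last exact/eqP.
have := congr1 (fun g : {ffun _ -> _} => g (s i)) E.
by rewrite /= [LHS]ffunE [RHS]ffunE [(relabel s t0) _]ffunE permK.
Qed.

End StandardPolytabloid.

Lemma ev_homog (R : comNzRingType) n (c : int) (v : tens R n) f :
  homog c v -> ev v f != 0 -> c = (\sum_(i < n) f i)%N%:Z.
Proof.
elim: n c v => [|n IH] c v.
  by rewrite /homog gr_nil ev_nil big_ord0; case: eqP => // _ <-; rewrite eqxx.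
elim/tens_ind: v => x y /homog_pairP[xc yc]; rewrite ev_pair big_ord_recr /=.
by case: (f n) => [/(IH _ _ yc) yE|/(IH _ _ xc)->]; rewrite ?addn0 // PoszD -yE subrK.
Qed.

Lemma rows_of_tabloid a c (f : nat -> bool) : (\sum_(i < a + c) f i)%N = c ->
  is_tabloid (Some (a, c)) (rows_of (a + c) f).
Proof.
move=> fc; have card1 : #|[set i | rows_of (a + c) f i == ord_max]| = c.
  rewrite -sum1dep_card -[RHS]fc big_mkcond; apply: eq_bigr => i _ /=.
  by rewrite ffunE; case: (f i).
have := cardsC [set i | rows_of (a + c) f i == ord_max]; rewrite card1 card_ord => card0.
apply/forallP=> r; rewrite /row_length; case: (r =P ord0) => [->|/eqP]; last first.
  by rewrite I2_max => /eqP->; rewrite card1.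
have <- : ~: [set i | rows_of (a + c) f i == ord_max] =
    [set i | rows_of (a + c) f i == ord0].
  by apply/setP=> i; rewrite !inE -I2_max negbK.
by apply/eqP; move: card0 => /=; lia.
Qed.

Lemma std_poly_val_intr (R : comNzRingType) n c f : (std_poly_val int n c f)%:~R = std_poly_val R n c f.
Proof.
rewrite /std_poly_val rmorphM !rmorph_prod; congr (_ * _); apply: eq_bigr => i _.
  by rewrite rmorphB /= !rmorph_nat.
by rewrite rmorph_nat.
Qed.

(** * Specht lattices as spaces of highest weight vectors, and purity *)

Section SpechtSpan.

Variables (a c : nat) (R : comNzRingType).
Hypothesis ca : (c <= a)%N.
Local Notation n := (a + c)%N.
Local Notation d := (Some (a, c)).

Let c2n : (c.*2 <= n)%N. Proof. lia. Qed.

Lemma emb_std : emb R (polytabloid d (std_tab ca)) = std_poly n c.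
Proof.
apply: ev_inj => f; rewrite ev_emb ev_std_poly //.
have [fT|fT] := boolP (is_tabloid d (rows_of n f)).
  pose T : tabloid n d := exist _ (rows_of n f) fT.
  rewrite -[rows_of n f]/(val T) ext_val (polytabloid_std ca (f := f)) //.
  exact: std_poly_val_intr.
rewrite ext_out // -ev_std_poly //; apply/esym/eqP; apply: contraNT fT => qf0.
have [qc _] := hw_std_poly R c2n.
by apply: rows_of_tabloid; have [] := ev_homog qc qf0.
Qed.

Lemma hw_polytabloid (t : {ffun 'I_n -> box n}) : is_tableau d t -> hw c%:Z (emb R (polytabloid d t)).
Proof.
move=> /(tableau_relabel ca)[s ->]; rewrite -permZ_act_polytabloid.
by apply: hw_emb_act; rewrite emb_std; apply: hw_std_poly.
Qed.

Lemma hw_emb_specht x : x \in @spechtZ_pred n d -> hw c%:Z (emb R x).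
Proof.
move=> /asboolP[k ->]; rewrite raddf_sum /=.
elim/big_rec: _ => [|t v tT vS]; first exact: hw0.
apply: hwD vS; rewrite raddfMz /= -scaler_int.
by apply: hwZ; apply: hw_polytabloid.
Qed.

Lemma poly_orbit_polytabloid (u : tens R n) : poly_orbit c u ->
  exists2 t : {ffun 'I_n -> box n}, is_tableau d t & u = emb R (polytabloid d t).
Proof.
elim=> [|j w jn _ [t tT ->]].
  by exists (std_tab ca); [apply: std_tab_is_tableau | rewrite emb_std].
pose i := Ordinal (ltnW jn); pose i' := Ordinal jn.
exists (relabel (tperm i i') t); first by rewrite is_tableau_relabel.
by rewrite -permZ_act_polytabloid (@emb_act_adj _ _ R i i').
Qed.

Lemma hw_span (v : tens R n) : hw c%:Z v ->
  exists r : {ffun 'I_n -> box n} -> R,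
    v = \sum_(t | is_tableau d t) r t *: emb R (polytabloid d t).
Proof.
move=> /(poly_span_hw c2n); elim=> {v} [|k u v /poly_orbit_polytabloid[t tT ->] _ [r ->]].
  by exists (fun=> 0); rewrite big1 // => t _; rewrite scale0r.
exists (fun s => (s == t)%:R * k + r s).
under [RHS]eq_bigr do rewrite scalerDl.
rewrite big_split /= [X in _ = X + _](bigD1 t) //= eqxx mul1r [X in _ = _ + X + _]big1 ?addr0 //.
by move=> s /andP[_ /negPf->]; rewrite mul0r scale0r.
Qed.

End SpechtSpan.

Lemma emb_int_inj n d : injective (@emb n d int).
Proof.
move=> x y E; apply/ffunP=> T; have := congr1 (fun v => ev v (bits_of (val T))) E.
by rewrite /= !ev_emb bits_ofK !ext_val !intz.
Qed.

Lemma tens_int_torsion_free n (v : tens int n) m : (0 < m)%N -> v *+ m = 0 -> v = 0.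
Proof.
move=> m0 vm; apply: ev_inj => f; have := congr1 (fun w => ev w f) vm.
rewrite /= -scaler_nat evZ ev0 => /eqP; rewrite mulf_eq0 pnatr_eq0.
by case: m m0 {vm} => //= m _ /eqP.
Qed.

(** The conditions defining [hw] are linear equations in a torsion-free module, so [m] can be
    cancelled; [hw_span] over the integers then returns to polytabloids. *)
Lemma spechtZ_pure a c m (x : permZ (a + c) (Some (a, c))) : (c <= a)%N -> (0 < m)%N ->
  x *+ m \in @spechtZ_pred _ _ -> x \in @spechtZ_pred _ _.
Proof.
move=> ca m0 /(hw_emb_specht int ca); rewrite raddfMn /= => -[xc x0].
have xS : hw c%:Z (emb int x).
  split=> [|i]; apply/eqP.
    rewrite -subr_eq0; apply/eqP/(tens_int_torsion_free m0).
    by move: xc; rewrite /homog raddfMn /= mulrnBl => ->; rewrite subrr.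
  apply/eqP/(tens_int_torsion_free m0).
  by have := x0 i; rewrite raddfMn.
have [r xE] := hw_span ca xS; apply/asboolP; exists r; apply: emb_int_inj.
rewrite xE raddf_sum; apply: eq_bigr => t _.
by rewrite raddfMz /= -[RHS]scaler_int intz.
Qed.

(** * The bilinear form in tabloid coordinates *)

Definition ffun_rcons n (b : 'I_2) (g : {ffun 'I_n -> 'I_2}) : {ffun 'I_n.+1 -> 'I_2} :=
  [ffun i => if unlift ord_max i is Some j then g j else b].

Lemma bits_of_rcons n b (g : {ffun 'I_n -> 'I_2}) i :
  bits_of (ffun_rcons b g) i = if i == n then b != ord0 else bits_of g i.
Proof.
have [lt_in|ni] := ltnP i n.
  have iE : i = lift ord_max (Ordinal lt_in) :> nat by rewrite lift_max.
  rewrite ltn_eqF // {1}iE bits_ofE ffunE liftK.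
  by rewrite -[i]/(nat_of_ord (Ordinal lt_in)) bits_ofE.
case: eqP => [->|/eqP in_]; first by rewrite -[n]/(val (ord_max : 'I_n.+1)) bits_ofE ffunE unlift_none.
by rewrite /bits_of !insubN // -leqNgt //; lia.
Qed.

Lemma dotp_sum (R : comNzRingType) n (v w : tens R n) :
  dotp v w = \sum_(g : {ffun 'I_n -> 'I_2}) ev v (bits_of g) * ev w (bits_of g).
Proof.
elim: n v w => [|n IH].
  move=> v w; rewrite dotp_nil (big_pred1 [ffun=> ord0]) => [|g]; last first.
    by apply/esym/eqP/ffunP=> -[].
  by rewrite !ev_nil.
elim/tens_ind=> x y; elim/tens_ind=> x' y'; rewrite dotp_pair !IH.
rewrite (reindex (fun bg : 'I_2 * {ffun 'I_n -> 'I_2} => ffun_rcons bg.1 bg.2)) /=; last first.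
  exists (fun g => (g ord_max, [ffun j => g (lift ord_max j)])) => [[b g]|g] _ /=.
    congr (_, _); first by rewrite ffunE unlift_none.
    by apply/ffunP=> j; rewrite !ffunE liftK.
  apply/ffunP=> i; rewrite ffunE; case: unliftP => [j|] -> //.
  by rewrite ffunE.
rewrite -(pair_bigA _ (fun b g => ev ((x, y) : tens R n.+1) (bits_of (ffun_rcons b g)) *
   ev ((x', y') : tens R n.+1) (bits_of (ffun_rcons b g)))) /=.
have E (z : tens R n) b (g : {ffun 'I_n -> 'I_2}) : ev z (bits_of (ffun_rcons b g)) = ev z (bits_of g).
  by apply: ev_ext => i lt_in; rewrite bits_of_rcons ltn_eqF.
rewrite big_ord_recl big_ord1; congr (_ + _); apply: eq_bigr => g _.
  by rewrite !ev_pair bits_of_rcons eqxx /= !E.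
by rewrite !ev_pair bits_of_rcons eqxx /= !E.
Qed.

Lemma dotp_emb n d (R : comNzRingType) (x y : permZ n d) :
  dotp (emb R x) (emb R y) = (\sum_T x T * y T)%:~R.
Proof.
rewrite dotp_sum (bigID (is_tabloid d)) /= [X in _ + X]big1 ?addr0; last first.
  by move=> g gT; rewrite !ev_emb bits_ofK ext_out // mul0r.
rewrite rmorph_sum /= (reindex_omap (fun T : tabloid n d => val T) insub) /=; last first.
  by move=> g gT; rewrite insubT.
rewrite (eq_bigl xpredT) => [|T]; last by rewrite valP valK eqxx.
by apply: eq_bigr => T _; rewrite !ev_emb bits_ofK !ext_val intrM.
Qed.

(** * Specht modules modulo p *)

Lemma Fp_scale_tens p (p_pr : prime p) n (k : 'F_p) (v : tens 'F_p n) : k *: v = v *+ k.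
Proof. by rewrite -scaler_nat natr_Zp. Qed.

Section SpechtEmbedding.

Variables (p : nat) (p_pr : prime p) (n : nat) (d : diagram).
Local Notation specht := (specht n d p_pr).

Let pF : p \in [pchar 'F_p]. Proof. exact: pchar_Fp. Qed.

Definition specht_emb (x : specht) : tens 'F_p n := emb 'F_p (spechtZ_val (repr x)).

Lemma specht_emb_pi v : specht_emb (\pi_specht v)%qT = emb 'F_p (spechtZ_val v).
Proof.
have [y {2}->] := specht_repr p_pr v.
by rewrite !raddfD /= !raddfMn /= (pchar_mulrn_tens pF) addr0.
Qed.

Lemma specht_emb_linear : linear specht_emb.
Proof.
move=> k x y; elim/quotW: x => x; elim/quotW: y => y.
have -> : k *: (\pi_specht x)%qT = (\pi_specht (x *+ k))%qT by rewrite raddfMn.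
by rewrite -raddfD !specht_emb_pi !raddfD /= !raddfMn /= Fp_scale_tens.
Qed.
HB.instance Definition _ :=
  GRing.isLinear.Build 'F_p specht (tens 'F_p n) _ specht_emb specht_emb_linear.

Lemma dotp_specht_emb x y : dotp (specht_emb x) (specht_emb y) = specht_form x y.
Proof. by rewrite dotp_emb. Qed.

End SpechtEmbedding.

Lemma specht_emb_equivariant p (p_pr : prime p) n d d' (phi : tens 'F_p n -> tens 'F_p n) s
    (x : specht n d p_pr) (y : specht n d' p_pr) :
  (forall j v, phi (swp j v) = swp j (phi v)) ->
  phi (specht_emb x) = specht_emb y -> phi (specht_emb (specht_act s x)) = specht_emb (specht_act s y).
Proof.
elim/quotW: x => x; elim/quotW: y => y phiS.
by rewrite !specht_actE !specht_emb_pi; apply: emb_equivariant.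
Qed.

Section SpechtImage.

Variables (p : nat) (p_pr : prime p) (a c : nat).
Hypothesis ca : (c <= a)%N.
Local Notation n := (a + c)%N.
Local Notation d := (Some (a, c)).
Local Notation specht := (specht n d p_pr).

(** A lift of a kernel element has all coefficients divisible by [p], and purity puts the quotient
    by [p] back into the Specht lattice. *)
Lemma specht_emb_inj : injective (@specht_emb p p_pr n d).
Proof.
suff K (x : specht) : specht_emb x = 0 -> x = 0.
  move=> x y E; apply/eqP; rewrite -subr_eq0; apply/eqP/K.
  by rewrite linearB /= E subrr.
elim/quotW: x => x; rewrite specht_emb_pi => x0.
have pdiv T : (p%:Z %| spechtZ_val x T)%Z.
  have := congr1 (fun v => ev v (bits_of (val T))) x0.
  rewrite /= ev_emb bits_ofK ext_val ev0 => /eqP.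
  by rewrite -(dvdz_pcharf (pchar_Fp p_pr)).
pose w : permZ n d := [ffun T => (spechtZ_val x T %/ p%:Z)%Z].
have wE : spechtZ_val x = w *+ p.
  apply/ffunP=> T; rewrite ffunMnE ffunE -mulr_natr natz divzK //.
have wS : w \in @spechtZ_pred n d.
  by apply: (spechtZ_pure ca (prime_gt0 p_pr)); rewrite -wE; apply: spechtZ_valP.
apply/eqP; rewrite specht_pi_eq0; apply/asboolP; exists (SpechtZ wS).
by apply: val_inj; rewrite raddfMn.
Qed.

(** Mod p, [hw_span] writes [v] in polytabloids; lifting the coefficients to integers gives a
    preimage. *)
Lemma specht_emb_image (v : tens 'F_p n) : hw c%:Z v <-> exists x : specht, specht_emb x = v.
Proof.
split=> [vS|[x <-]]; last exact/hw_emb_specht/spechtZ_valP.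
have [r ->] := hw_span ca vS.
pose x : permZ n d := \sum_(t | is_tableau d t) polytabloid d t *~ (r t : nat).
have xS : x \in @spechtZ_pred n d by apply/asboolP; exists (fun t => (r t : nat)%:Z).
exists (\pi_specht (SpechtZ xS))%qT; rewrite specht_emb_pi /= raddf_sum.
apply: eq_bigr => t _; rewrite raddfMz /= Fp_scale_tens //.
Qed.

End SpechtImage.

(** * Traces along a resolution *)

Section Trace.

Variable F : fieldType.
Implicit Types (U V W : vectType F).

Lemma lin_traceC V W (A : {linear V -> W}) (B : {linear W -> V})
    (f : {linear W -> W}) (g : {linear V -> V}) :
  (forall x, f x = A (B x)) -> (forall x, g x = B (A x)) -> lin_trace f = lin_trace g.
Proof.
move=> fE gE; rewrite /lin_trace /=.
pose e := vbasis {:W}%VS; pose e' := vbasis {:V}%VS.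
transitivity (\sum_(i < \dim {:W}) \sum_(j < \dim {:V})
    coord e' j (B e`_i) * coord e i (A e'`_j)).
  apply: eq_bigr => i _; rewrite fE {1}(coord_vbasis (memvf (B e`_i))).
  rewrite !linear_sum; apply: eq_bigr => j _; rewrite !linearZ //=.
rewrite exchange_big; apply: eq_bigr => j _; rewrite gE.
rewrite [in RHS](coord_vbasis (memvf (A e'`_j))) !linear_sum.
by apply: eq_bigr => i _; rewrite !linearZ /= mulrC.
Qed.

Lemma lin_traceD V (f g h : {linear V -> V}) :
  (forall x, f x = g x + h x) -> lin_trace f = lin_trace g + lin_trace h.
Proof.
move=> fE; rewrite /lin_trace -big_split /=; apply: eq_bigr => i _.
by rewrite fE linearD.
Qed.

Lemma lin_trace_eq0 V (f : {linear V -> V}) : (forall x, f x = 0) -> lin_trace f = 0.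
Proof. by move=> f0; rewrite /lin_trace big1 // => i _; rewrite f0 linear0. Qed.

(** [pinv A \o A] is a projection with the same kernel as [A]. For [f] preserving that kernel,
    [lin_trace (f \o (pinv A \o A))] is thus the trace of [f] on the quotient by it. *)
Definition pinv V W (A : {linear V -> W}) : {linear W -> V} := (linfun A)^-1%VF.

Lemma pinvK V W (A : {linear V -> W}) x : A (pinv A (A x)) = A x.
Proof.
have := limg_lfunVK (memv_img (linfun A) (memvf x)).
by rewrite !lfunE.
Qed.

(** The trace on [V] splits into those on [V / ker B] and on [ker B]; the latter is the image of
    [A], isomorphic to [U / ker A]. Here [q] projects onto [ker B]. *)
Lemma lin_trace_exact U V W (A : {linear U -> V}) (B : {linear V -> W})
    (f : {linear U -> U}) (g : {linear V -> V}) :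
  (forall x, A (f x) = g (A x)) -> (forall x, B x = 0 <-> exists y, A y = x) ->
  lin_trace g = lin_trace (g \o (pinv B \o B)) + lin_trace (f \o (pinv A \o A)).
Proof.
move=> Af exAB; pose q : {linear V -> V} := idfun \- (pinv B \o B).
rewrite (lin_traceD (g := g \o (pinv B \o B)) (h := g \o q)) => [|x]; last first.
  by rewrite /= -linearD addrC subrK.
congr (_ + _); apply: (lin_traceC (A := A) (B := f \o (pinv A \o q))) => x /=.
  have /exAB[y <-] : B (x - pinv B (B x)) = 0 by rewrite linearB /= pinvK subrr.
  by rewrite Af pinvK.
have -> : B (A x) = 0 by apply/exAB; exists x.
by rewrite linear0 subr0.
Qed.

Lemma lin_trace_resolution (V : nat -> vectType F) W
    (D : forall j, {linear V j.+1 -> V j}) (E : {linear V 0 -> W})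
    (f : forall j, {linear V j -> V j}) (g : {linear W -> W}) N :
  (forall j x, D j (f j.+1 x) = f j (D j x)) -> (forall x, E (f 0%N x) = g (E x)) ->
  (forall j x, D j x = 0 <-> exists y, D j.+1 y = x) ->
  (forall x, E x = 0 <-> exists y, D 0%N y = x) ->
  (forall z, exists x, E x = z) -> (forall x : V N.+1, x = 0) ->
  lin_trace g = \sum_(j < N.+1) (-1) ^+ j * lin_trace (f j).
Proof.
move=> Df Ef exD exE surE VN0.
have gT : lin_trace g = lin_trace (f 0%N \o (pinv E \o E)).
  apply: (lin_traceC (A := E) (B := f 0%N \o pinv E)) => x //=.
  by have [y <-] := surE x; rewrite Ef pinvK.
(* The remainder is the trace on [V k.+1] modulo [ker (D k)]; it vanishes at [k = N]. *)
suff H k : lin_trace g = \sum_(j < k.+1) (-1) ^+ j * lin_trace (f j) +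
    (-1) ^+ k.+1 * lin_trace (f k.+1 \o (pinv (D k) \o D k)).
  by rewrite (H N) [X in _ + _ * X]lin_trace_eq0 ?mulr0 ?addr0.
elim: k => [|k IH].
  rewrite big_ord1 expr0 mul1r expr1 mulN1r gT.
  by rewrite (lin_trace_exact (Df 0%N) exE) addrK.
rewrite big_ord_recr /= IH -addrA; congr (_ + _).
rewrite (lin_trace_exact (Df k.+1) (exD k)) mulrDr -addrA.
by rewrite [(-1) ^+ k.+2]exprS mulN1r mulNr subrr addr0.
Qed.

End Trace.

(** * The resolution *)

Section TwoRowDiagram.

Variables (p : nat) (p_pr : prime p) (n : nat) (r1 r2 : int).
Hypotheses (nE : r1 + r2 = n%:Z) (r21 : r2 <= r1).
Local Notation d := (mk_diagram r1 r2).

(** [P] also ranges over the number of boxes, so that [n] can be replaced by the form [a + c] used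
    for Specht modules. *)
Lemma mk_diagramP (P : nat -> diagram -> int -> Prop) :
  (r2 < 0 -> P n None r2) ->
  (forall a c, (c <= a)%N -> P (a + c)%N (Some (a, c)) c%:Z) ->
  P n d r2.
Proof.
move=> Pneg Ppos; rewrite /mk_diagram; case: (lerP 0 r2) => r2_0; last first.
  by rewrite andbF; apply: Pneg.
have r1_0 : 0 <= r1 by lia.
have -> : n = (`|r1| + `|r2|)%N by lia.
by rewrite r1_0 /= -{3}(gez0_abs r2_0); apply: Ppos; lia.
Qed.

Lemma specht_emb_mk_inj : injective (@specht_emb p p_pr n d).
Proof.
move: mk_diagramP => /(_ (fun n d _ => injective (@specht_emb p p_pr n d))); apply.
  by move=> _ x y _; rewrite [x]specht_undefined [y]specht_undefined.
exact: specht_emb_inj.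
Qed.

Lemma specht_emb_mk_image (v : tens 'F_p n) :
  hw r2 v <-> exists x : specht n d p_pr, specht_emb x = v.
Proof.
move: mk_diagramP v => /(_ (fun n d r => forall v : tens 'F_p n,
  hw r v <-> exists x : specht n d p_pr, specht_emb x = v)); apply => [r2_lt0|a c ca] v.
  split=> [[/(homog_lt0 r2_lt0)-> _]|[x <-]]; first by exists 0; rewrite linear0.
  by rewrite [x]specht_undefined linear0; apply: hw0.
exact: specht_emb_image.
Qed.

End TwoRowDiagram.

Lemma specht_map p (p_pr : prime p) n d d' k :
  injective (@specht_emb p p_pr n d') ->
  (forall x : specht n d p_pr,
     exists y : specht n d' p_pr, specht_emb y = iter k (@raise 'F_p n) (specht_emb x)) ->
  exists f : {linear specht n d p_pr -> specht n d' p_pr},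
    forall x, specht_emb (f x) = iter k (@raise 'F_p n) (specht_emb x).
Proof.
move=> inj /choice[f fE].
have f_lin : linear f by move=> a x y; apply: inj; rewrite fE !linearP /= !fE.
pose fL := GRing.isLinear.Build _ _ _ _ f f_lin.
by exists (HB.pack_for {linear specht n d p_pr -> specht n d' p_pr} f fL).
Qed.

Lemma dmod_proj p (p_pr : prime p) n ab d : d = Some ab ->
  exists eps : {linear specht n d p_pr -> dmod n (Some ab) p_pr},
    [/\ forall s x, eps (specht_act s x) = dmod_act s (eps x),
        forall x, eps x = 0 <-> forall y : specht n d p_pr, dotp (specht_emb x) (specht_emb y) = 0
      & forall z, exists x, eps x = z].
Proof.
move=> ->; pose D := dmod n (Some ab) p_pr.
have pi_lin : linear (\pi_D)%qT.
  by move=> k x y; rewrite raddfD; congr (_ + _); apply: (raddfMn (\pi_D)%qT).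
pose piL := GRing.isLinear.Build _ _ _ _ (\pi_D)%qT pi_lin.
exists (HB.pack_for {linear specht n (Some ab) p_pr -> D} (\pi_D)%qT piL); split=> [s x|x|z] /=.
- by rewrite dmod_actE.
- split=> [/eqP|xR].
    by rewrite dmod_pi_eq0 => /asboolP xR y; rewrite dotp_specht_emb xR.
  by apply/eqP; rewrite dmod_pi_eq0; apply/asboolP => y; rewrite -dotp_specht_emb.
- by exists (repr z); rewrite reprK.
Qed.

(** Kept as an integer: it becomes negative once the diagram is undefined, and there the space of
    highest weight vectors is zero as well. *)
Definition tau_row2 (p a b j : nat) : int :=
  if odd j then a%:Z - (j.+1./2 * p)%:Z + 1 else b%:Z - (j./2 * p)%:Z.

Lemma tauE p a b j :
  tau p a b j = mk_diagram ((a + b)%:Z - tau_row2 p a b j) (tau_row2 p a b j).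
Proof. by rewrite /tau /tau_row2; case: ifP => _; congr mk_diagram; lia. Qed.

Lemma fsbig_nat_ord (V : nmodType) N (f : nat -> V) :
  (forall i, (N <= i)%N -> f i = 0) ->
  \sum_(i \in [set: nat]%classic) f i = \sum_(i < N) f i.
Proof.
move=> f0; rewrite (fsbigE (iota 0 N)) ?iota_uniq //.
  by rewrite -(big_mkord xpredT) /index_iota subn0; apply: eq_bigl => i; rewrite in_setT.
by move=> i _; rewrite mem_iota -leqNgt; apply: f0.
Qed.

Section Resolution.

Variables (p a b : nat) (p_pr : prime p).
Hypotheses (p_ge3 : (3 <= p)%N) (b_le_a : (b <= a)%N) (ab_le : (a - b <= p - 2)%N).
Local Notation n := (a + b)%N.
Local Notation row2 := (tau_row2 p a b).
Local Notation S j := (specht n (tau p a b j) p_pr).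

(** The exponent of [F] in the map from [S j.+1] to [S j]. *)
Definition gap (j : nat) : nat := if odd j then (a - b).+1 else (p - (a - b).+1)%N.

Lemma tau_row2S j : row2 j.+1 = row2 j - (gap j)%:Z.
Proof.
rewrite /tau_row2 /gap /=; case: (boolP (odd j)) => /= jo; first by lia.
by rewrite mulSn; lia.
Qed.

Lemma gapS j : (gap j + gap j.+1 = p)%N.
Proof. by rewrite /gap /=; case: (odd j) => /=; lia. Qed.

(** For even [j] this is the bound [a - b <= p - 2]; positivity of [gap 0] puts the image of the
    first map inside the radical. *)
Lemma gap_gt0 j : (0 < gap j)%N.
Proof. by rewrite /gap; case: (odd j); lia. Qed.

(** The congruence needed for [hw_iter_raise] and [hw_exact], with [k = gap j] and [q = j.+1]. *)
Lemma row2_weight j : n%:Z - 2 * row2 j.+1 + 1 = (gap j)%:Z + j.+1%:Z * p%:Z.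
Proof.
rewrite /tau_row2 /gap oddS -PoszM; case: (boolP (odd j)) => jo /=.
  have -> : (j.+1 * p = uphalf j * p + uphalf j * p)%N by rewrite -mulnDl; congr (_ * _)%N; lia.
  by move: (uphalf j * p)%N => x; lia.
have -> : (j.+1 * p = j./2 * p + j./2 * p + p)%N.
  by rewrite -mulnDl -mulSnr; congr (_ * _)%N; lia.
by rewrite mulSn; move: (j./2 * p)%N => x; lia.
Qed.

Lemma row2_0 : row2 0 = b%:Z.
Proof. by rewrite /tau_row2 /= mul0n subr0. Qed.

Lemma row2_le j : row2 j <= n%:Z - row2 j.
Proof.
case: j => [|j]; first by rewrite row2_0; lia.
by have := row2_weight j; have : (0 <= (gap j)%:Z + j.+1%:Z * p%:Z) by []; lia.
Qed.

Lemma tau_inj j : injective (@specht_emb p p_pr n (tau p a b j)).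
Proof. by rewrite tauE; apply: specht_emb_mk_inj; [rewrite subrK | apply: row2_le]. Qed.

Lemma tau_image j (v : tens 'F_p n) :
  hw (row2 j) v <-> exists x : S j, specht_emb x = v.
Proof. by rewrite tauE; apply: specht_emb_mk_image; [rewrite subrK | apply: row2_le]. Qed.

Let pF : p \in [pchar 'F_p]. Proof. exact: pchar_Fp. Qed.

Lemma specht_resolution :
  exists (f : forall j, {linear S j.+1 -> S j})
         (eps : {linear S 0 -> dmod n (Some (a, b)) p_pr}),
    [/\ forall j s x, f j (specht_act s x) = specht_act s (f j x),
        forall s x, eps (specht_act s x) = dmod_act s (eps x),
        forall j x, f j x = 0 <-> exists y, f j.+1 y = x,
        forall x, eps x = 0 <-> exists y, f 0%N y = x
      & forall z, exists x, eps x = z].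
Proof.
have ex j : exists f : {linear S j.+1 -> S j},
    forall x, specht_emb (f x) = iter (gap j) (@raise 'F_p n) (specht_emb x).
  apply: specht_map (@tau_inj j) _ => x; apply/tau_image.
  have xS : hw (row2 j.+1) (specht_emb x) by apply/tau_image; exists x.
  have gp : (gap j <= p)%N by have := gapS j; lia.
  have := hw_iter_raise pF xS gp (row2_weight j).
  by rewrite tau_row2S subrK.
have fP j := cid (ex j); pose f j := projT1 (fP j).
have fE j x : specht_emb (f j x) = iter (gap j) (@raise 'F_p n) (specht_emb x) := projT2 (fP j) x.
have tau0 : tau p a b 0 = Some (a, b).
  by rewrite tauE row2_0 /mk_diagram; have -> : n%:Z - b%:Z = a%:Z by lia.
have [eps [eps_act eps0 eps_sur]] := dmod_proj p_pr n tau0.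
have pgap j : (p - gap j)%N = gap j.+1 by have := gapS j; lia.
exists f, eps; split=> // [j s x|j x|x].
- apply: tau_inj; rewrite fE; apply: specht_emb_equivariant; last by rewrite fE.
  by move=> i v; elim: (gap j) => //= k ->; rewrite raise_swp.
- have xS : hw (row2 j.+1) (specht_emb x) by apply/tau_image; exists x.
  split=> [fx0|[y <-]]; last first.
    apply: tau_inj; rewrite !fE linear0 -iterD gapS.
    exact: (iter_raise_pchar pF).
  have gp : (gap j <= p)%N by have := gapS j; lia.
  (* As [q = j.+1] is positive, the orthogonality condition is vacuous and the cocycle condition is
     [f j x = 0]. *)
  have [||u uS xu] := hw_exact pF gp (row2_weight j) xS; first by [].
    by rewrite -fE fx0 linear0.
  rewrite pgap -tau_row2S in uS xu.
  have [y yu] := (tau_image j.+2 u).1 uS.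
  by exists y; apply: tau_inj; rewrite fE yu.
- have xS : hw b%:Z (specht_emb x) by rewrite -row2_0; apply/tau_image; exists x.
  split=> [/eps0 x0|[y <-]]; last first.
    apply/eps0 => z; rewrite fE; have := gap_gt0 0; case: (gap 0) => // k _.
    have [_ zk] : hw (row2 0) (specht_emb z) by apply/tau_image; exists z.
    exact: dotp_iter_raise.
  have gp : (gap 1 <= p)%N by have := gapS 0; lia.
  (* At the end of the complex [q = 0] and [k = gap 1 = a - b + 1]; membership in the radical is the
     orthogonality condition. *)
  have w0 : n%:Z - 2 * b%:Z + 1 = (gap 1)%:Z + 0%:Z * p%:Z by rewrite /gap /=; lia.
  have [_ _ w||u uS xu] := hw_exact pF gp w0 xS.
  + by rewrite -row2_0 => /tau_image[y <-].
  + by [].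
  have g0 : (p - gap 1)%N = gap 0 by have := gapS 0; lia.
  rewrite g0 -row2_0 -tau_row2S in uS xu.
  have [y yu] := (tau_image 1 u).1 uS.
  by exists y; apply: tau_inj; rewrite fE yu.
Qed.

Lemma dmod_char_tau (s : 'S_n) :
  dmod_char p_pr (Some (a, b)) s =
  \sum_(i \in [set: nat]%classic) (-1) ^+ i * specht_char p_pr (tau p a b i) s.
Proof.
have [f [eps [f_act eps_act f_ex eps_ex eps_sur]]] := specht_resolution.
have tauN j : (n < j)%N -> tau p a b j = None by apply: tau_undefined.
(* Diagrams of index above [n] are undefined, so the sum and the resolution both stop at index
   [n]. *)
rewrite (@fsbig_nat_ord _ n.+1) => [|i ni]; last first.
  by rewrite tauN // specht_char_undefined mulr0.
rewrite /dmod_char /specht_char.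
apply: (lin_trace_resolution (E := eps) (D := f)
  (f := fun j => @specht_act n (tau p a b j) p p_pr s)) => // [j x|x|x].
- exact: f_act.
- exact: eps_act.
by move: x; rewrite tauN // => x; apply: specht_undefined.
Qed.

End Resolution.

Theorem theorem1 (p n a b : nat) (p_pr : prime p) (p_ge3 : (3 <= p)%N)
    (n_boxes : n = (a + b)%N) (b_le_a : (b <= a)%N)
    (ab_le : (a - b <= p - 2)%N) :
  (exists (f : forall j : nat, {linear specht n (tau p a b j.+1) p_pr ->
                                       specht n (tau p a b j) p_pr})
          (eps : {linear specht n (tau p a b 0) p_pr ->
                         dmod n (Some (a, b)) p_pr}),
    [/\ forall (j : nat) (s : 'S_n) x,
          f j (specht_act s x) = specht_act s (f j x),
        forall (s : 'S_n) x, eps (specht_act s x) = dmod_act s (eps x),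
        forall j x, f j x = 0 <-> exists y, f j.+1 y = x,
        forall x, eps x = 0 <-> exists y, f 0%N y = x
      & forall z, exists x, eps x = z]) /\
  (forall s : 'S_n,
    dmod_char p_pr (Some (a, b)) s =
    \sum_(i \in [set: nat]%classic)
       (-1) ^+ i * specht_char p_pr (tau p a b i) s).
Proof.
by subst n; split; [apply: specht_resolution | apply: dmod_char_tau].
Qed.
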